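(* Let $D,n_0\in\mathbb{N}$ (positive integers), let $0<L_{min}\le L_{max}$, and let $\mathcal{Q}\in\mathfrak{Q}'_{D,n_0,L_{min},L_{max}}$ be a finite open quantum graph (unbalanced, with data bounded by $D,n_0,L_{min},L_{max}$). Set $Y=-\frac{\ln(D+n_0)}{L_{min}}$ and $$a=\frac{\ln2}{\left(2\frac{\ln32}{L_{min}}-Y\right)^2}.$$ Let $x_0\in\mathbb{R}$ and let $\alpha>0$ be such that $$\frac{\alpha}{L_{min}}\ge\left(\left[Y-\frac{\ln16}{L_{min}}\right]^2-\frac1a\ln\left(L_{min}\,(\ln2)\,\frac{1-e^{-a/L_{min}^2}}{8\left(2L_{max}\frac{1+\ln(D+n_0)}{L_{min}}+0.6\right)}\sqrt{\frac{\pi}{a}}\right)\right)^{1/2}.$$ Then the number of resonances of $\mathcal{Q}$, counted with multiplicity, in the vertical strip around $x_0$ satisfies $$\mathcal{N}_{\mathcal{Q}}\left(\left\{z\in\mathbb{C}:\ x_0-\frac{\alpha}{L_{min}}\le\operatorname{Re}z\le x_0+\frac{\alpha}{L_{min}}\right\}\right)\ge\frac{\mathcal{L}_{\mathcal{Q}}}{8}\sqrt{\frac{\pi}{a}}.$$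
   Context: A quantum graph $\mathcal{Q}=(V,E,L,\mathbf{n})$ consists of a graph $(V,E)$ with vertex set $V$ and edge set $E$, a map $L:E\to(0,\infty)$ (edge lengths), and a map $\mathbf{n}:V\to\mathbb{N}\cup\{0\}$ (number of semi-infinite edges, or leads, attached to each vertex). It is finite if $(V,E)$ is finite. The (internal) degree $d(v)$ is the number of $e\in E$ to which $v$ belongs, and the total length is $\mathcal{L}_{\mathcal{Q}}=\sum_{e\in E}L(e)$. $\mathfrak{Q}_{D,n_0,L_{min},L_{max}}$ is the set of quantum graphs with $d(v)\le D$ and $\mathbf{n}(v)\le n_0$ for all $v\in V$, and $L_{min}\le L(e)\le L_{max}$ for all $e\in E$. $\mathfrak{Q}'_{D,n_0,L_{min},L_{max}}$ is the subset of those that are unbalanced: $\mathbf{n}(v)\ne d(v)$ for all $v\in V$. $B=B(\mathcal{Q})$ is the set of oriented internal edges (bonds), two for each $e\in E$. For $b\in B$, $\hat b$ is the reversed bond, $o_b$ its origin, $t_b$ its terminus, and $L_b$ the length of the underlying edge. For $b,b'\in B$ put $\sigma_{b,b'}=\frac{2}{\mathbf{n}(v)+d(v)}$ if $o_b=o_{b'}=v$ and $b\ne b'$; $\sigma_{b,b'}=\frac{2}{\mathbf{n}(v)+d(v)}-1$ if $b=b'$ with $o_b=v$; and $\sigma_{b,b'}=0$ if $o_b\ne o_{b'}$. For $z\in\mathbb{C}$ define the $B\times B$ matrices $D_{\mathcal{Q}}(z)_{b,b'}=\delta_{b,b'}e^{izL_b}$, $(S_{\mathcal{Q}})_{b,b'}=\sigma_{b,\hat{b'}}$,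 and $U_{\mathcal{Q}}(z)=S_{\mathcal{Q}}D_{\mathcal{Q}}(z)$. Resonances: let $B_{ext}$ be the set of leads (the $\mathbf{n}(v)$ leads at $v$ having origin $v$) and $\hat B=B\cup B_{ext}$. A number $z\in\mathbb{C}$ is a scattering resonance of a finite $\mathcal{Q}$ if there is a nonzero family $f=(f_b)_{b\in\hat B}$ with $f_b\in C^2([0,L_b])$ for $b\in B$, $f_b\in C^2([0,\infty))$ for $b\in B_{ext}$, $f_b(\cdot)=f_{\hat b}(L_b-\cdot)$ for $b\in B$, such that: (continuity) $f_b(0)=f_{b'}(0)$ whenever $o_b=o_{b'}$; (current conservation) $\sum_{b\in\hat B:\,o_b=v}f_b'(0)=0$ for all $v\in V$; $-f_b''=z^2f_b$ for all $b\in\hat B$; and $f_b(x)=f_b(0)e^{izx}$ for all $b\in B_{ext}$. A known fact is that $z\neq0$ is a resonance iff $\det(\mathrm{Id}-U_{\mathcal{Q}}(z))=0$. The multiplicity of $z_0$ is by convention (including for $z_0=0$) the order of $z_0$ as a zero of $z\mapsto\det(\mathrm{Id}-U_{\mathcal{Q}}(z))$. For $\Omega\subset\mathbb{C}$, $\mathcal{N}_{\mathcal{Q}}(\Omega)$ is the number of resonances of $\mathcal{Q}$ in $\Omega$ counted with multiplicity, i.e. the number of zeros of this determinant in $\Omega$ with multiplicity. *)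

(* Defs.v *)
From HB Require Import structures.
From mathcomp Require Import all_boot all_order all_algebra.
From mathcomp Require Import complex.
From mathcomp Require Import all_classical all_reals all_analysis.

Set Implicit Arguments.
Unset Strict Implicit.
Unset Printing Implicit Defensive.

Import Order.TTheory GRing.Theory Num.Theory.
Import numFieldNormedType.Exports.

Local Open Scope classical_set_scope.
Local Open Scope complex_scope.
Local Open Scope ring_scope.

(* A finite quantum graph.  The endpoints of an edge are listed in a reference
   order [src e], [tgt e], which only serves to name its two bonds.  Parallel
   edges are allowed; self-loops are not, because the degree counts the edges
   to which a vertex belongs and a loop would give two bonds at its vertex. *)
Record quantum_graph (R : realType) := QuantumGraph {
  vertex : finType;
  edge : finType;
  src : edge -> vertex;
  tgt : edge -> vertex;
  src_neq_tgt : forall e, src e != tgt e;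
  edge_len : edge -> R;
  edge_len_gt0 : forall e, 0 < edge_len e;
  nleads : vertex -> nat
}.

Section QuantumGraph.
Context {R : realType}.
Implicit Types (Q : quantum_graph R) (z : R[i]).

Definition degree Q (v : vertex Q) : nat :=
  #|[pred e : edge Q | (v == src e) || (v == tgt e)]|.

Definition total_length Q : R := \sum_(e : edge Q) edge_len e.

Definition bounded_graph (D n0 : nat) (Lmin Lmax : R) Q : Prop :=
  (forall v : vertex Q, (degree v <= D)%N /\ (nleads v <= n0)%N) /\
  (forall e : edge Q, Lmin <= edge_len e <= Lmax).

Definition unbalanced Q : Prop := forall v : vertex Q, nleads v != degree v.

(* The bond (e, true) runs from [src e] to [tgt e], and (e, false) is its
   reversal. *)
Definition bond Q : finType := (edge Q * bool)%type.

Definition bond_rev Q (b : bond Q) : bond Q := (b.1, ~~ b.2).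
Definition bond_orig Q (b : bond Q) : vertex Q :=
  if b.2 then src b.1 else tgt b.1.
Definition bond_len Q (b : bond Q) : R := edge_len b.1.

(* e^w for complex w. *)
Definition cexp (w : R[i]) : R[i] :=
  (expR (complex.Re w))%:C * (cos (complex.Im w) +i* sin (complex.Im w)).

Definition sigma Q (b b' : bond Q) : R :=
  if bond_orig b == bond_orig b' then
    2 / (nleads (bond_orig b) + degree (bond_orig b))%:R - (b == b')%:R
  else 0.

(* Matrices over the bonds are indexed by 'I_#|bond Q|, through [enum_val]. *)
Definition D_mx Q z : 'M[R[i]]_#|bond Q| :=
  \matrix_(i, j) ((i == j)%:R * cexp ('i%C * z * (bond_len (enum_val i))%:C)).

Definition S_mx Q : 'M[R[i]]_#|bond Q| :=
  \matrix_(i, j) (sigma (enum_val i) (bond_rev (enum_val j)))%:C.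

Definition U_mx Q z : 'M[R[i]]_#|bond Q| := S_mx Q *m D_mx Q z.

Definition secular_det Q z : R[i] := \det (1%:M - U_mx Q z).

(* [R[i]^o] is the complex plane as a normed space over itself. *)
Definition is_derive_on (A : set R) (f g : R -> R[i]^o) : Prop :=
  forall t, A t ->
    (fun x => (f x - f t) / (x - t)%:C : R[i]^o) @ within A t^' --> g t.

(* f is of class C^2 on A, with first and second derivatives f1 and f2
   (one-sided at the endpoints of A). *)
Definition is_C2_on (A : set R) (f f1 f2 : R -> R[i]^o) : Prop :=
  [/\ is_derive_on A f f1, is_derive_on A f1 f2 & {within A, continuous f2}].

Definition lead Q : finType := {v : vertex Q & 'I_(nleads v)}.

Definition ext_bond Q : finType := (bond Q + lead Q)%type.

Definition ext_orig Q (b : ext_bond Q) : vertex Q :=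
  match b with inl b => bond_orig b | inr l => tag l end.

Definition ext_dom Q (b : ext_bond Q) : set R :=
  match b with inl b => `[0, bond_len b] | inr _ => `[0, +oo[ end.

Definition is_resonance Q z : Prop :=
  exists f f1 f2 : ext_bond Q -> R -> R[i],
    (exists b x, ext_dom b x /\ f b x != 0) /\
    (forall b, is_C2_on (ext_dom b) (f b) (f1 b) (f2 b)) /\
    (forall (b : bond Q) x, ext_dom (inl b) x ->
       f (inl b) x = f (inl (bond_rev b)) (bond_len b - x)) /\
    (forall b b', ext_orig b = ext_orig b' -> f b 0 = f b' 0) /\
    (forall v, \sum_(b : ext_bond Q | ext_orig b == v) f1 b 0 = 0) /\
    (forall b x, ext_dom b x -> - f2 b x = z ^+ 2 * f b x) /\
    (forall (l : lead Q) x, 0 <= x ->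
       f (inr l) x = f (inr l) 0 * cexp ('i%C * z * x%:C)).

(* Order of vanishing at z of a holomorphic f: the number of leading complex
   derivatives f z, f' z, ... that are zero (0 if f z <> 0, and +oo if f
   vanishes identically near z). *)
Definition zero_order (f : R[i] -> R[i]^o) z : \bar R :=
  ereal_sup [set k%:R%:E | k in [set k : nat |
    forall j : nat, (j < k)%N -> (f^`(j))%classic z = 0]].

Definition multiplicity Q z : \bar R := zero_order (secular_det Q) z.

Definition resonance_count Q (Omega : set R[i]) : \bar R :=
  \esum_(z in [set z | is_resonance Q z] `&` Omega) multiplicity Q z.

End QuantumGraph.

(* Main.v *)
Require Import Defs.
From HB Require Import structures.
From mathcomp Require Import all_boot all_order all_algebra.
From mathcomp Require Import perm complex.
From mathcomp Require Import all_classical all_reals all_analysis.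
From mathcomp Require Import ring lra.
Set Implicit Arguments.
Unset Strict Implicit.
Unset Printing Implicit Defensive.
Import Order.TTheory GRing.Theory Num.Theory.
Import numFieldNormedType.Exports.
Local Open Scope classical_set_scope.
Local Open Scope complex_scope.
Local Open Scope ring_scope.

(* The secular determinant det (1 - U(z)) is an exponential sum
   sum_A c_A exp (i z l_A) over sets of bonds A.  If all lengths are integer
   multiples, at least 2M, of a step d, it is a polynomial p in w = exp (i z d).
   Unbalancedness gives |S u| <= |u| <= kap |S u| with kap = D + n0, so the roots
   w_j of p satisfy 1 <= |w_j| and |w_j|^(2M) <= kap.  Moreover p = 1 mod X^(2M),
   so by Newton's identities the power sums of the 1 / w_j of exponents
   1, ..., 2M - 1 vanish, and sum_j phi (rho / w_j) = deg p * phi 0 for every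
   polynomial phi of degree < 2M.  With rho = 1 - d h and phi a truncated
   combination of the Poisson kernel (1 + w) / (1 - w) and the Koebe function
   w / (1 - w)^2, the real part of phi (rho / w_j) is nonpositive unless w_j lies
   in a window around 1, and bounded always; taking real parts of the identity
   bounds the number of roots in the window from below by a multiple of the
   total length, which is about d * deg p / 2.  For general lengths one rounds
   them up to multiples of d = Lmin / (2M), translates x0 to 0 by absorbing
   exp (i x0 L_b) into S, and lets M tend to infinity along an ultrafilter; the
   rescaled roots (w_j - 1) / (i d) converge to zeros of the secular determinant,
   multiplicities included.  The free parameters h and beta (the weight of the
   Poisson kernel) are then fixed so that the count matches the claimed one. *)

(** * Modulus and exponential of complex numbers *)

Import Normc.

(** The two kernels have complementary roles. The Poisson kernel supplies the nonzero constant term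
    [phi 0], but its real part is positive on the whole disc, so alone it cannot localise roots. The
    Koebe function vanishes at 0, hence leaves the right side of the identity unchanged. With
    [w = 1 + i d z] one has [1 - rho / w] close to [d (h + i z)], so [d^2 phi] is close to
    [beta / (h + i z) + 1 / (h + i z)^2]. Far from the window both real parts decay like
    [1 / |h + i z|^2], the second one negatively, and a small [beta] is absorbed. The shift [h > 0]
    keeps all arguments at distance at least [d h] from the pole at 1: this bounds the contribution
    of each root in the window and makes the errors of truncation powers of
    [(1 - d h)^M <= exp (- h L / 2)]. The window is a disc which in the variable [z] becomes, in the
    limit, the disc of centre [i h] and squared radius [A^2 + h^2]. It cuts the real axis in
    [[- A, A]], and its part in the half-plane [Im z <= 0], where the zeros lie, has
    [|Re z| <= A]. *)

Section ComplexNorm.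
Context {R : realType}.
Implicit Types (x y : R) (w z : R[i]).

Lemma sqr_normc_ReIm z : normc z ^+ 2 = complex.Re z ^+ 2 + complex.Im z ^+ 2.
Proof. by case: z => a b /=; rewrite sqr_sqrtr // addr_ge0 ?sqr_ge0. Qed.

Lemma normc_ge0 z : 0 <= normc z.
Proof. by case: z => a b /=; apply: sqrtr_ge0. Qed.
Hint Resolve normc_ge0 : core.

Lemma normcD w z : normc (w + z) <= normc w + normc z.
Proof. exact: le_normcD. Qed.

Lemma normcNz z : normc (- z) = normc z.
Proof. exact: normcN. Qed.

Lemma normcB w z : normc (w - z) <= normc w + normc z.
Proof. by rewrite -[normc z]normcNz; apply: normcD. Qed.

Lemma normc_distC w z : normc (w - z) = normc (z - w).
Proof. by rewrite -[RHS]normcNz opprB. Qed.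

Lemma normc_sub_ge w z : normc w - normc z <= normc (w - z).
Proof. by rewrite lerBlDr -{1}(subrK z w) normcD. Qed.

Lemma normcMz w z : normc (w * z) = normc w * normc z.
Proof. exact: normcM. Qed.

Lemma normcX z n : normc (z ^+ n) = normc z ^+ n.
Proof. by elim: n => [|n IH]; rewrite ?expr0 ?normc1 // !exprS normcMz IH. Qed.

Lemma normc_real x : normc x%:C = `|x|.
Proof. by rewrite /= expr0n addr0 sqrtr_sqr. Qed.

Lemma normc_eq0 z : (normc z == 0) = (z == 0).
Proof. by apply/eqP/eqP => [/eq0_normc //|->]; rewrite normc0. Qed.

Lemma normc_gt0 z : (0 < normc z) = (z != 0).
Proof. by rewrite lt0r normc_ge0 andbT normc_eq0. Qed.

Lemma normc_sum (I : Type) (r : seq I) (P : pred I) (F : I -> R[i]) :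
  normc (\sum_(i <- r | P i) F i) <= \sum_(i <- r | P i) normc (F i).
Proof.
elim/big_ind2: _ => // [|a b c d ab cd]; first by rewrite normc0.
by apply: le_trans (normcD _ _) _; apply: lerD.
Qed.

Lemma normc_ge_absRe z : `|complex.Re z| <= normc z.
Proof.
case: z => a b /=; rewrite -sqrtr_sqr ler_sqrt ?addr_ge0 ?sqr_ge0 //.
by rewrite lerDl sqr_ge0.
Qed.

Lemma normc_ge_absIm z : `|complex.Im z| <= normc z.
Proof.
case: z => a b /=; rewrite -sqrtr_sqr ler_sqrt ?addr_ge0 ?sqr_ge0 //.
by rewrite lerDr sqr_ge0.
Qed.

Lemma normc_le_ReIm z : normc z <= `|complex.Re z| + `|complex.Im z|.
Proof.
rewrite -(ler_pXn2r (n := 2)) ?nnegrE ?addr_ge0 // sqr_normc_ReIm.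
rewrite sqrrD !real_normK ?num_real // -addrA lerD2l lerDr.
by rewrite mulrn_wge0 ?mulr_ge0.
Qed.

Lemma normrC_normc z : `|z| = (normc z)%:C.
Proof. by case: z. Qed.

Lemma ReD w z : complex.Re (w + z) = complex.Re w + complex.Re z.
Proof. by case: w; case: z. Qed.

Lemma Re_sum (I : Type) (r : seq I) (P : pred I) (F : I -> R[i]) :
  complex.Re (\sum_(i <- r | P i) F i) = \sum_(i <- r | P i) complex.Re (F i).
Proof.
elim/big_ind2: _ => // a b c d <- <-; exact: ReD.
Qed.

Lemma ReZ x z : complex.Re (x%:C * z) = x * complex.Re z.
Proof. by case: z => a b /=; rewrite mul0r subr0. Qed.

End ComplexNorm.
#[local] Hint Resolve normc_ge0 : core.

Section ComplexExponential.
Context {R : realType}.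
Implicit Types (x y : R) (w z : R[i]).

Lemma sin_mvt y : exists2 c, `|c| <= `|y| & sin y = cos c * y.
Proof.
have pos : forall u : R, 0 < u -> exists2 c : R, `|c| <= u & sin u = cos c * u.
  move=> u u_gt0; have cs : {within `[0, u], continuous (@sin R)}.
    by apply: continuous_subspaceT => x; apply: continuous_sin.
  have [c] := MVT u_gt0 (fun x _ => is_derive_sin x) cs.
  rewrite in_itv /= sin0 !subr0 => /andP[c0 ct] ->; exists c => //.
  by rewrite gtr0_norm // ltW.
have [y0|y0|->] := ltgtP y 0; last by exists 0; rewrite ?sin0 ?mulr0.
- have [|c ct e] := pos (- y); first by rewrite oppr_gt0.
  exists c; first by rewrite (ltr0_norm y0).
  by apply: oppr_inj; rewrite -sinN e mulrN.
- by have [c ct e] := pos y y0; exists c; rewrite // (gtr0_norm y0).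
Qed.

Lemma abs_sin_le y : `|sin y| <= `|y|.
Proof.
have [c _ ->] := sin_mvt y; rewrite normrM ler_piMl //; exact: cos_max.
Qed.

Lemma abs_cos_sub1_le y : `|cos y - 1| <= y ^+ 2.
Proof.
have -> : cos y - 1 = - (sin (y / 2) ^+ 2 *+ 2).
  have -> : cos y = cos (y / 2 + y / 2) by rewrite -splitr.
  by have := cos2Dsin2 (y / 2); rewrite cosD mulr2n; lra.
rewrite normrN normrMn normrX.
have : `|sin (y / 2)| ^+ 2 <= `|y / 2| ^+ 2.
  by rewrite ler_pXn2r ?nnegrE // abs_sin_le.
rewrite !real_normK ?num_real // => le1.
have -> : sin (y / 2) ^+ 2 *+ 2 = 2 * sin (y / 2) ^+ 2 by ring.
by have := sqr_ge0 y; lra.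
Qed.

Lemma abs_sin_sub_le y : `|y| <= 1 -> `|sin y - y| <= y ^+ 2.
Proof.
move=> y1; have [c cy ->] := sin_mvt y.
rewrite -{2}[y]mul1r -mulrBl normrM -real_normK ?num_real // expr2.
apply: ler_wpM2r => //; apply: le_trans (abs_cos_sub1_le c) _.
rewrite -real_normK ?num_real // expr2; apply: (le_trans _ cy).
by rewrite ler_piMl // (le_trans cy).
Qed.

Lemma expR_taylor1 x : `|x| <= 1 / 2 -> 0 <= expR x - 1 - x <= 2 * x ^+ 2.
Proof.
move=> x1; have /andP[xl xu] : - (1 / 2) <= x <= 1 / 2 by rewrite -ler_norml.
apply/andP; split; first by have := expR_ge1Dx x; lra.
have e1 : 1 - x <= (expR x)^-1 by rewrite -expRN; apply: expR_ge1Dx.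
have e0 := expR_gt0 x.
have : expR x * (1 - x) <= 1.
  by rewrite -[leRHS](mulfV (lt0r_neq0 e0)) ler_pM2l.
have h : 0 <= x ^+ 2 * (1 - 2 * x) by rewrite mulr_ge0 ?sqr_ge0 //; lra.
move=> h2.
have : expR x * (1 - x) <= (1 + x + 2 * x ^+ 2) * (1 - x).
  apply: le_trans h2 _.
  have -> : (1 + x + 2 * x ^+ 2) * (1 - x) = 1 + x ^+ 2 * (1 - 2 * x) by ring.
  lra.
rewrite ler_pM2r; lra.
Qed.

Lemma cexpD w z : cexp (w + z) = cexp w * cexp z.
Proof.
case: w => a b; case: z => c d; rewrite /cexp /= expRD cosD sinD.
by apply/eqP; rewrite eq_complex /=; apply/andP; split; apply/eqP; ring.
Qed.

Lemma cexp0 : cexp (0 : R[i]) = 1.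
Proof.
by rewrite /cexp /= expR0 cos0 sin0; apply/eqP;
  rewrite eq_complex /=; apply/andP; split; apply/eqP; ring.
Qed.

Lemma cexp_sum (I : Type) (r : seq I) (P : pred I) (F : I -> R[i]) :
  cexp (\sum_(i <- r | P i) F i) = \prod_(i <- r | P i) cexp (F i).
Proof.
by elim/big_ind2: _ => // [|a b c d <- <-]; rewrite ?cexp0 // cexpD.
Qed.

Lemma cexpMn z n : cexp (z *+ n) = cexp z ^+ n.
Proof. by elim: n => [|n IH]; rewrite ?cexp0 // mulrS cexpD IH exprS. Qed.

Lemma normc_cexp w : normc (cexp w) = expR (complex.Re w).
Proof.
rewrite /cexp normcMz normc_real ger0_norm ?expR_ge0 //.
by rewrite /= cos2Dsin2 sqrtr1 mulr1.
Qed.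

(** The constant 8 is generous: only the quadratic order of the error matters, since all uses let
    [w] tend to 0 or take it small enough. *)
Lemma cexp_taylor1 w : normc w <= 1 / 2 ->
  normc (cexp w - 1 - w) <= 8 * normc w ^+ 2.
Proof.
move=> w1; have := le_trans (normc_ge_absRe w) w1.
have := le_trans (normc_ge_absIm w) w1.
rewrite sqr_normc_ReIm; case: w {w1} => x y y1 x1.
have {}y1 : `|y| <= 1 / 2 by []; have {}x1 : `|x| <= 1 / 2 by [].
rewrite [complex.Re (x +i* y)]/= [complex.Im (x +i* y)]/=.
apply: le_trans (normc_le_ReIm _) _.
have -> : complex.Re (cexp (x +i* y) - 1 - (x +i* y)) =
    (expR x - 1 - x) + expR x * (cos y - 1) by rewrite /cexp /=; ring.
have -> : complex.Im (cexp (x +i* y) - 1 - (x +i* y)) =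
    (expR x - 1) * sin y + (sin y - y) by rewrite /cexp /=; ring.
have /andP[e1 e2] := expR_taylor1 x1.
have c1 := abs_cos_sub1_le y.
have s1 : `|sin y - y| <= y ^+ 2 by apply: abs_sin_sub_le; lra.
have /andP[xl xu] : - (1 / 2) <= x <= 1 / 2 by rewrite -ler_norml.
have xx : x ^+ 2 <= 1 / 4.
  have : 0 <= (1 / 2 - x) * (1 / 2 + x) by rewrite mulr_ge0; lra.
  rewrite -[X in _ <= X -> _]opprK; lra.
have ex2 : expR x <= 2 by lra.
have ex1 : `|expR x - 1| <= 2 * `|x|.
  have -> : expR x - 1 = (expR x - 1 - x) + x by ring.
  apply: le_trans (ler_normD _ _) _; rewrite (ger0_norm e1).
  have : x ^+ 2 <= 1 / 2 * `|x| by rewrite -real_normK ?num_real // expr2 ler_wpM2r.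
  lra.
have A : `|(expR x - 1 - x) + expR x * (cos y - 1)| <= 2 * x ^+ 2 + 2 * y ^+ 2.
  apply: le_trans (ler_normD _ _) _; rewrite (ger0_norm e1) lerD //.
  by rewrite normrM ger0_norm ?expR_ge0 // ler_pM // expR_ge0.
have B : `|(expR x - 1) * sin y + (sin y - y)| <= x ^+ 2 + y ^+ 2 + y ^+ 2.
  apply: le_trans (ler_normD _ _) _; apply: lerD => //; rewrite normrM.
  apply: (@le_trans _ _ (2 * `|x| * `|y|)).
    by rewrite ler_pM // abs_sin_le.
  have := sqr_ge0 (`|x| - `|y|); rewrite sqrrB !real_normK ?num_real // -mulr_natr.
  lra.
have := sqr_ge0 x; have := sqr_ge0 y; lra.
Qed.

End ComplexExponential.

(** * The test polynomial *)

Section TestPolynomial.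
Context {R : realType}.
Implicit Types (w z : R[i]) (M : nat).

Lemma ler_sqr_ge0 (x y : R) : 0 <= x -> x <= y -> x ^+ 2 <= y ^+ 2.
Proof. by move=> x0 xy; rewrite ler_pXn2r ?nnegrE // (le_trans x0). Qed.

Lemma Re_div w z : complex.Re (w / z) = complex.Re (w * z^*) / normc z ^+ 2.
Proof.
have [->|z0] := eqVneq z 0.
  by rewrite invr0 mulr0 normc0 expr0n invr0 mulr0.
rewrite invc_norm normrC_normc.
have -> : w * ((normc z)%:C ^- 2 * z^*) = ((normc z ^+ 2)^-1)%:C * (w * z^*).
  by rewrite fmorphV rmorphXn /= mulrCA.
by rewrite ReZ mulrC.
Qed.

Lemma Re_cayley w :
  complex.Re ((1 + w) / (1 - w)) = (1 - normc w ^+ 2) / normc (1 - w) ^+ 2.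
Proof.
rewrite Re_div; congr (_ / _); rewrite sqr_normc_ReIm.
by case: w => a b /=; ring.
Qed.

(** In terms of [v = |1 - w|^2] the positive term is of order [v^-2] and the negative one of order
    [v^-1], the rate of the Poisson kernel in [Re_cayley]. *)
Lemma Re_koebe w : w != 1 ->
  complex.Re (w / (1 - w) ^+ 2) =
    (1 - normc w ^+ 2) ^+ 2 / (2 * (normc (1 - w) ^+ 2) ^+ 2)
    - (1 + normc w ^+ 2) / (2 * normc (1 - w) ^+ 2).
Proof.
move=> w1; have v0 : normc (1 - w) != 0 by rewrite normc_eq0 subr_eq0 eq_sym.
have -> : complex.Re (w / (1 - w) ^+ 2) =
    ((1 - normc w ^+ 2) ^+ 2 - (1 + normc w ^+ 2) * normc (1 - w) ^+ 2)
      / (2 * (normc (1 - w) ^+ 2) ^+ 2).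
  rewrite Re_div normcX.
  have -> : complex.Re (w * ((1 - w) ^+ 2)^*) =
      ((1 - normc w ^+ 2) ^+ 2 - (1 + normc w ^+ 2) * normc (1 - w) ^+ 2) / 2.
    by rewrite !sqr_normc_ReIm; case: w {w1 v0} => a b /=; field.
  by field.
by field.
Qed.

(* Its coefficients are [B * (1/2, 1 - 1/M, ..., 1 - (M-1)/M, 0, ...)], a smoothly
   cut Poisson kernel, plus those of ['X * (1 + ... + 'X^(M-1))^2], a cut Koebe
   function; in both cases the cut costs only powers of [w ^+ M]. *)
Definition test_poly M (B : R) : {poly R[i]} :=
  (B%:C)%:P * ((M%:R^-1)%:P * \sum_(j < M) \sum_(k < j.+1) 'X^k - (1 / 2)%:P)
  + 'X * (\sum_(k < M) 'X^k) ^+ 2.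

Lemma size_test_poly M B : (0 < M)%N -> (size (test_poly M B) <= M.*2)%N.
Proof.
move=> M0; have geo n : (size (\sum_(k < n) 'X^k : {poly R[i]})%R <= n)%N.
  by apply: (leq_trans (size_sum _ _ _)); apply/bigmax_leqP => i _; rewrite size_polyXn.
apply: (leq_trans (size_polyD _ _)); rewrite geq_max; apply/andP; split.
  rewrite mul_polyC; apply: (leq_trans (size_scale_leq _ _)).
  apply: (leq_trans (size_polyD _ _)); rewrite geq_max; apply/andP; split.
    rewrite mul_polyC; apply: (leq_trans (size_scale_leq _ _)).
    apply: (leq_trans (size_sum _ _ _)); apply/bigmax_leqP => i _.
    by apply: (leq_trans (geo _)); rewrite -addnn (leq_trans (ltn_ord i)) ?leq_addr.
  by rewrite size_polyN (leq_trans (size_polyC_leq1 _)) // double_gt0.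
rewrite mulrC; apply: (leq_trans (size_polyMleq _ _)); rewrite size_polyX addn2 /=.
rewrite expr2; apply: (leq_ltn_trans (size_polyMleq _ _)); rewrite -addnn.
apply: (@leq_ltn_trans (M + M).-1); first by rewrite -!subn1 leq_sub2r // leq_add // geo.
by rewrite prednK // addn_gt0 M0.
Qed.

Lemma test_poly_at0 M B : (0 < M)%N -> (test_poly M B).[0] = (B / 2)%:C.
Proof.
move=> M0; rewrite /test_poly !hornerE horner_sum.
under eq_bigr => i _.
  rewrite horner_sum big_ord_recl /= expr0 hornerE big1 => [|j _]; last first.
    by rewrite hornerXn expr0n.
  over.
rewrite sumr_const card_ord addr0 mulVf ?pnatr_eq0 -?lt0n //.
rewrite -[B / 2]/(B * 2^-1) rmorphM fmorphV /= rmorph_nat; field.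
by [].
Qed.

(** Averaging the geometric sums subtracts [B / M] times a Koebe function, up to a multiple of
    [w ^+ M]. This is the origin of the weight [1 - b] in the bounds below. *)
Lemma test_polyE M B w : (0 < M)%N -> w != 1 ->
  (test_poly M B).[w] = (B / 2)%:C * ((1 + w) / (1 - w))
    + w / (1 - w) ^+ 2 * ((1 - w ^+ M) ^+ 2 - (B / M%:R)%:C * (1 - w ^+ M)).
Proof.
move=> M0 w1; have v0 : 1 - w != 0 by rewrite subr_eq0 eq_sym.
have Mn : M%:R != 0 :> R[i] by rewrite pnatr_eq0 -lt0n.
have geo n : (\sum_(k < n) 'X^k : {poly R[i]}).[w] = (1 - w ^+ n) / (1 - w).
  rewrite horner_sum; under eq_bigr do rewrite hornerXn.
  have := subrX1 w n; rewrite -opprB -[w - 1]opprB mulNr => /oppr_inj ->.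
  by rewrite mulrAC mulfV // mul1r.
have avg : (\sum_(j < M) \sum_(k < j.+1) 'X^k : {poly R[i]}).[w] =
    (M%:R - w * ((1 - w ^+ M) / (1 - w))) / (1 - w).
  rewrite horner_sum; under eq_bigr do rewrite geo.
  rewrite -mulr_suml; congr (_ / _); rewrite sumrB sumr_const card_ord.
  congr (_ - _); rewrite -geo horner_sum mulr_sumr.
  by apply: eq_bigr => i _; rewrite hornerXn exprS.
rewrite /test_poly !hornerE avg geo.
rewrite !rmorphM !fmorphV /= !rmorph_nat; field.
by rewrite Mn v0.
Qed.

Section Bounds.
Variables (M : nat) (B e : R) (w : R[i]).
Let b := B / M%:R.
Let eta := 2 * e + e ^+ 2 + b * e.
Hypotheses (M0 : (0 < M)%N) (B0 : 0 <= B) (b1 : b <= 1) (w1 : normc w < 1)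
  (we : normc w ^+ M <= e).

Let b0 : 0 <= b. Proof. by rewrite divr_ge0. Qed.

Let w_neq1 : w != 1.
Proof. by apply: contraTneq w1 => ->; rewrite normc1 ltxx. Qed.

Let v_gt0 : 0 < normc (1 - w).
Proof. by rewrite normc_gt0 subr_eq0 eq_sym. Qed.

Let e0 : 0 <= e. Proof. by apply: le_trans we; rewrite exprn_ge0. Qed.

(** With [u = w ^+ M], the kernels differ from their cut versions by the Koebe function times
    [- 2 u + u^2 + b u], of modulus at most [eta]. *)
Lemma Re_test_poly_le :
  complex.Re (test_poly M B).[w] <=
    B / 2 * ((1 - normc w ^+ 2) / normc (1 - w) ^+ 2)
    + (1 - b) * complex.Re (w / (1 - w) ^+ 2)
    + eta * (normc w / normc (1 - w) ^+ 2).
Proof.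
rewrite test_polyE // -/b ReD ReZ Re_cayley -addrA lerD2l.
set k := w / _; set u := w ^+ M.
have -> : k * ((1 - u) ^+ 2 - b%:C * (1 - u)) =
    (1 - b)%:C * k + k * (- (u * 2) + u ^+ 2 + b%:C * u).
  by rewrite rmorphB /= rmorph1; ring.
rewrite ReD ReZ lerD2l.
apply: le_trans (le_trans (ler_norm _) (normc_ge_absRe _)) _.
have k0 : 0 <= normc w / normc (1 - w) ^+ 2 by rewrite divr_ge0 // exprn_ge0.
rewrite normcMz mulrC normcMz normcV normcX; apply: (ler_wpM2r k0).
have ue : normc u <= e by rewrite normcX.
apply: le_trans (normcD _ _) _; apply: lerD; last first.
  by rewrite normcMz normc_real ger0_norm // ler_wpM2l.
apply: le_trans (normcD _ _) _; apply: lerD.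
  rewrite normcNz normcMz mulrC -[2]/(2%:R) -(rmorph_nat (real_complex R)).
  by rewrite normc_real ger0_norm // ler_wpM2l.
by rewrite normcX ler_pXn2r ?nnegrE.
Qed.

Lemma Re_test_poly_le_max (r : R) : normc w <= r -> r < 1 ->
  complex.Re (test_poly M B).[w] <= B / (1 - r) + (1 - b + eta) / (1 - r) ^+ 2.
Proof.
move=> wr r1; apply: le_trans Re_test_poly_le _.
have v1 : 1 - normc w <= normc (1 - w) by rewrite -{1}(@normc1 R) normc_sub_ge.
have s0 : 0 < 1 - normc w by lra.
have v2 : (1 - normc w) ^+ 2 <= normc (1 - w) ^+ 2 by apply: ler_sqr_ge0 => //; exact: ltW.
have s2 : 0 < (1 - normc w) ^+ 2 by rewrite exprn_gt0.
have vv : 0 < normc (1 - w) ^+ 2 by rewrite exprn_gt0.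
have k_le : normc w / normc (1 - w) ^+ 2 <= ((1 - r) ^+ 2)^-1.
  apply: (@le_trans _ _ ((normc (1 - w) ^+ 2)^-1)).
    by rewrite ler_piMl ?invr_ge0 ?ltW.
  rewrite lef_pV2 ?posrE ?exprn_gt0 //; last by lra.
  by apply: le_trans v2; apply: ler_sqr_ge0; lra.
have c_le : (1 - normc w ^+ 2) / normc (1 - w) ^+ 2 <= 2 / (1 - r).
  rewrite ler_pdivrMr // mulrAC ler_pdivlMr; last by lra.
  apply: (@le_trans _ _ (2 * (1 - normc w) ^+ 2)); last by rewrite ler_wpM2l.
  have -> : (1 - normc w ^+ 2) * (1 - r) = (1 - normc w) * ((1 + normc w) * (1 - r)).
    by ring.
  have -> : 2 * (1 - normc w) ^+ 2 = (1 - normc w) * (2 * (1 - normc w)) by ring.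
  by rewrite ler_pM2l // ler_pM //; have := normc_ge0 w; lra.
have eta0 : 0 <= eta by rewrite !addr_ge0 ?mulr_ge0 ?exprn_ge0.
rewrite -addrA; apply: lerD.
  apply: (@le_trans _ _ (B / 2 * (2 / (1 - r)))).
    by rewrite ler_wpM2l // divr_ge0.
  by rewrite le_eqVlt; apply/orP; left; apply/eqP; field; lra.
rewrite [leRHS]mulrDl; apply: lerD; last by rewrite ler_wpM2l.
rewrite ler_wpM2l ?subr_ge0 //; apply: le_trans k_le.
apply: le_trans (le_trans (ler_norm _) (normc_ge_absRe _)) _.
by rewrite normcMz normcV normcX.
Qed.

(** All tails decay like [1 / v] with [v = |1 - w|^2], so after factoring this out the sign is
    decided by a condition that no longer contains [w]. The hypothesis on [v] enters only through
    [(1 - r2)^2 / (2 v) <= 2 y^2 / R2]. *)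
Lemma Re_test_poly_le0 (d y R2 : R) :
  0 < R2 -> 0 < d -> 0 <= y -> 1 - normc w ^+ 2 <= 2 * d * y ->
  d ^+ 2 * R2 <= normc (1 - w) ^+ 2 ->
  B * d * y + (1 - b) * (2 * y ^+ 2 / R2 - 1 + d * y) + eta <= 0 ->
  complex.Re (test_poly M B).[w] <= 0.
Proof.
move=> R20 d0 y0 wy vR neg; apply: le_trans Re_test_poly_le _.
rewrite Re_koebe //.
have vv : 0 < normc (1 - w) ^+ 2 by rewrite exprn_gt0.
set v := normc (1 - w) ^+ 2 in vR vv *; set r2 := normc w ^+ 2 in wy *.
have r21 : r2 <= 1 by rewrite exprn_ile1 // ltW.
have -> : B / 2 * ((1 - r2) / v) + (1 - b) * ((1 - r2) ^+ 2 / (2 * v ^+ 2)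
    - (1 + r2) / (2 * v)) + eta * (normc w / v) =
  (B * ((1 - r2) / 2) + (1 - b) * ((1 - r2) ^+ 2 / (2 * v) - (1 + r2) / 2)
   + eta * normc w) / v by field; rewrite gt_eqF.
rewrite pmulr_lle0 ?invr_gt0 //; apply: le_trans neg.
have eta0 : 0 <= eta by rewrite !addr_ge0 ?mulr_ge0 ?exprn_ge0.
apply: lerD; last by rewrite ler_piMr // ltW.
apply: lerD; first by rewrite -mulrA ler_wpM2l //; lra.
rewrite ler_wpM2l ?subr_ge0 //.
have : (1 - r2) ^+ 2 / (2 * v) <= 2 * y ^+ 2 / R2.
  have v2 : 0 < 2 * v by lra.
  rewrite ler_pdivrMr // mulrAC ler_pdivlMr //.
  apply: (@le_trans _ _ ((2 * d * y) ^+ 2 * R2)).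
    by apply: ler_wpM2r; [exact: ltW|apply: ler_sqr_ge0; lra].
  have -> : (2 * d * y) ^+ 2 * R2 = 4 * y ^+ 2 * (d ^+ 2 * R2) by ring.
  have -> : 2 * y ^+ 2 * (2 * v) = 4 * y ^+ 2 * v by ring.
  by rewrite ler_wpM2l ?mulr_ge0 ?sqr_ge0.
by lra.
Qed.

End Bounds.
End TestPolynomial.

(** * Power sums and the secular determinant as an exponential sum *)

Section PowerSums.
Variable F : fieldType.
Implicit Types (ls : seq F) (m : nat).

(** The logarithmic derivative [- P' / P = \sum_l l / (1 - l X)] of [P = \prod_l (1 - l X)], with
    each geometric series cut modulo [X^m]: Newton's identities without power series. *)
Lemma power_sum_series ls m : exists r : {poly F},
  (\prod_(l <- ls) (1 - l *: 'X)) * (\sum_(l <- ls) \sum_(k < m) l ^+ k.+1 *: 'X^k)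
  = - (\prod_(l <- ls) (1 - l *: 'X))^`() + 'X^m * r.
Proof.
elim: ls => [|l ls [r IH]]; first by exists 0; rewrite !big_nil !mulr0 derivC oppr0 addr0.
rewrite !big_cons; set p := \prod_(_ <- _) _ in IH *; set s := \sum_(_ <- _) _ in IH *.
exists (- (l ^+ m.+1 *: p) + (1 - l *: 'X) * r).
have geo : (1 - l *: 'X) * (\sum_(k < m) l ^+ k.+1 *: 'X^k) = l%:P - l ^+ m.+1 *: 'X^m.
  have := subrX1 (l *: 'X : {poly F}) m.
  rewrite -opprB -[_ - 1]opprB mulNr => /oppr_inj e.
  have -> : \sum_(k < m) l ^+ k.+1 *: 'X^k = l%:P * \sum_(k < m) (l *: 'X) ^+ k :> {poly F}.
    rewrite mulr_sumr; apply: eq_bigr => i _.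
    by rewrite exprZn mul_polyC scalerA exprS.
  by rewrite mulrCA -e exprZn mulrBr mulr1 mul_polyC scalerA exprS.
rewrite derivM derivB derivC derivZ derivX sub0r.
rewrite mulrDr mulrAC geo -mulrA IH -!mul_polyC; ring.
Qed.

Lemma power_sums_eq0 ls m (q : {poly F}) k :
  \prod_(l <- ls) (1 - l *: 'X) = 1 + 'X^m * q -> (0 < k < m)%N ->
  \sum_(l <- ls) l ^+ k = 0.
Proof.
move=> e; case: k => // k /andP[_ km].
have [r] := power_sum_series ls m; rewrite e.
set s := \sum_(_ <- _) _ => /(congr1 (fun p : {poly F} => p`_k)).
have km' := ltnW km.
rewrite mulrDl mul1r !coefD -mulrA !coefXnM km' !addr0 coefN coef_deriv coefD.
rewrite coefXnM km coef1 addr0 mul0rn oppr0 => s_k; rewrite -[RHS]s_k coef_sum.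
apply: eq_bigr => l _; rewrite coef_sum (bigD1 (Ordinal km')) //= big1 => [|i ik].
  by rewrite coefZ coefXn eqxx mulr1 addr0.
rewrite coefZ coefXn; case: eqP => [ki|]; rewrite ?mulr0 //.
by case/eqP: ik; apply: val_inj.
Qed.

Lemma sum_horner_power_sums ls m (f : {poly F}) (c : F) :
  (forall k, (0 < k < m)%N -> \sum_(l <- ls) l ^+ k = 0) -> (size f <= m)%N ->
  \sum_(l <- ls) f.[c * l] = f.[0] *+ size ls.
Proof.
move=> s0 fm; under eq_bigr => l _ do rewrite (horner_coef_wide _ fm).
rewrite exchange_big /=; case: m s0 fm => [|m] s0 fm.
  rewrite big_ord0; move: fm; rewrite leqn0 size_poly_eq0 => /eqP ->.
  by rewrite horner0 mul0rn.
rewrite big_ord_recl [X in _ + X]big1 => [|i _] /=; last first.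
  under eq_bigr => l _ do rewrite exprMn mulrA.
  by rewrite -mulr_sumr s0 ?mulr0 // ltnS ltn_ord.
under eq_bigr do rewrite mulr1; rewrite addr0 horner_coef0.
by rewrite big_const_seq count_predT iter_addr_0.
Qed.

End PowerSums.

Section SecularExpansion.
Variables (T : comPzRingType) (n : nat).
Implicit Types (S : 'M[T]_n) (A : {set 'I_n}) (d : 'I_n -> T).

(** Up to the sign [(-1)^|A|], the principal minor of [S] on [A]: the determinant whose columns in
    [A] come from [- S] and the others from the identity. Summing over all permutations makes the
    expansion a mere distribution of products of sums. *)
Definition minor_coef S A : T :=
  \sum_(s : 'S_n) (-1) ^+ s * \prod_i (if i \in A then - S (s i) i else (s i == i)%:R).

Lemma det_one_sub_diag S d :
  \det (1%:M - S *m (\matrix_(i, j) ((i == j)%:R * d i))) =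
    \sum_A minor_coef S A * \prod_(i in A) d i.
Proof.
rewrite -det_tr /determinant; under [RHS]eq_bigr => A _ do rewrite mulr_suml.
rewrite exchange_big; apply: eq_bigr => s _.
under [RHS]eq_bigr => A _ do rewrite -mulrA.
rewrite -mulr_sumr; congr (_ * _).
have entry (i : 'I_n) : (1%:M - S *m (\matrix_(i, j) ((i == j)%:R * d i)))^T i (s i) =
    - S (s i) i * d i + (s i == i)%:R.
  rewrite !mxE addrC; congr (_ + _); rewrite mulNr; congr (- _).
  rewrite (bigD1 i) //= big1 => [|j ji]; first by rewrite mxE eqxx mul1r addr0.
  by rewrite mxE (negPf ji) mul0r mulr0.
under eq_bigr => i _ do rewrite entry.
rewrite bigA_distr; apply: eq_big => [A|A _]; first by rewrite inE.
rewrite [\prod_(i in A) d i]big_mkcond -big_split /=; apply: eq_bigr => i _.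
by case: ifP; rewrite ?mulr1.
Qed.

Lemma minor_coef0 S : minor_coef S finset.set0 = 1.
Proof.
rewrite -(det1 T n) -det_tr; apply: eq_bigr => s _; congr (_ * _).
by apply: eq_bigr => i _; rewrite inE !mxE.
Qed.

Lemma minor_coefT S : minor_coef S finset.setT = \det (- S).
Proof.
by rewrite -det_tr; apply: eq_bigr => s _; congr (_ * _);
  apply: eq_bigr => i _; rewrite inE !mxE.
Qed.

Lemma minor_coef_scale S (e : 'I_n -> T) A :
  minor_coef (\matrix_(i, j) (S i j * e j)) A = minor_coef S A * \prod_(i in A) e i.
Proof.
rewrite /minor_coef mulr_suml; apply: eq_bigr => s _; rewrite -mulrA; congr (_ * _).
rewrite [\prod_(i in A) e i]big_mkcond -big_split /=; apply: eq_bigr => i _.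
by rewrite mxE; case: ifP; rewrite ?mulr1 ?mulNr.
Qed.

End SecularExpansion.

(** * Roots of the bond polynomial *)

Section BondPolynomial.
Context {R : realType} {n : nat}.
Local Notation C := R[i].
Implicit Types (S : 'M[C]_n) (u v : 'cV[C]_n) (k : 'I_n -> nat) (d : 'I_n -> C).

Definition sqnorm u : R := \sum_i normc (u i 0) ^+ 2.

(** Substitute for unitarity: leads turn the scattering matrix into a contraction, whose inverse is
    still bounded by [kap]. *)
Definition quasi_isometry S (kap : R) : Prop :=
  forall u, sqnorm (S *m u) <= sqnorm u <= kap ^+ 2 * sqnorm (S *m u).

Definition diag_fun d : 'M[C]_n := \matrix_(i, j) ((i == j)%:R * d i).

Lemma diag_fun_mul d u i : (diag_fun d *m u) i 0 = d i * u i 0.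
Proof.
rewrite mxE (bigD1 i) //= big1 => [|j ji]; first by rewrite mxE eqxx mul1r addr0.
by rewrite mxE eq_sym (negPf ji) !mul0r.
Qed.

Lemma sqnorm_ge0 u : 0 <= sqnorm u.
Proof. by rewrite /sqnorm; apply: sumr_ge0 => i _; rewrite exprn_ge0 ?normc_ge0. Qed.

Lemma sqnorm_eq0 u : sqnorm u <= 0 -> u = 0.
Proof.
move=> u0; have /eqP : sqnorm u == 0 by rewrite eq_le u0 sqnorm_ge0.
rewrite /sqnorm => /eqP; rewrite psumr_eq0 => [/allP u00|i _]; last by rewrite exprn_ge0 ?normc_ge0.
apply/matrixP => i j; rewrite mxE ord1; have := u00 i (mem_index_enum i).
by rewrite expf_eq0 /= normc_eq0 => /eqP.
Qed.

Lemma det0_col (A : 'M[C]_n) : \det A = 0 -> exists2 v : 'cV[C]_n, v != 0 & A *m v = 0.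
Proof.
rewrite -det_tr => /eqP/det0P[v v0 vA]; exists v^T.
  by rewrite -(inj_eq trmx_inj) trmxK trmx0.
by apply: trmx_inj; rewrite trmx_mul trmxK vA trmx0.
Qed.

Lemma quasi_isometry_det S kap : quasi_isometry S kap -> \det (- S) != 0.
Proof.
move=> iso; apply/eqP => /det0_col[v /eqP v0 Sv]; apply: v0; apply: sqnorm_eq0.
have /andP[_] := iso v; have -> : S *m v = 0 by rewrite -[S]opprK mulNmx Sv oppr0.
suff -> : sqnorm 0 = 0 by rewrite mulr0.
by apply: big1 => i _; rewrite mxE normc0 expr0n.
Qed.

Lemma ltr_sum_sqnorm (a b : 'I_n -> R) v : v != 0 -> (forall i, a i < b i) ->
  \sum_i a i * normc (v i 0) ^+ 2 < \sum_i b i * normc (v i 0) ^+ 2.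
Proof.
move=> v0 ab; have [i vi] : exists i, v i 0 != 0.
  apply/existsP; apply: contraNT v0; rewrite negb_exists => /forallP v00.
  by apply/eqP/matrixP => i j; rewrite mxE ord1; apply/eqP; rewrite -[_ == _]negbK v00.
rewrite (bigD1 i) //= [ltRHS](bigD1 i) //= ltr_leD //.
  by rewrite ltr_pM2r // exprn_gt0 // normc_gt0.
by apply: ler_sum => j _; rewrite ler_wpM2r ?exprn_ge0 ?normc_ge0 // ltW.
Qed.

(** A kernel vector satisfies [v = S D v], so [|v| <= |D v| <= kap |v|]. The first inequality fails
    if all [|d i| < 1], the second if all [|d i| > kap]. *)
Lemma secular_zero_size S kap d : quasi_isometry S kap ->
  \det (1%:M - S *m diag_fun d) = 0 ->
  (exists i, 1 <= normc (d i)) /\ (0 <= kap -> exists i, normc (d i) <= kap).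
Proof.
move=> iso /det0_col[v v0]; rewrite mulmxBl mul1mx -mulmxA => /eqP.
rewrite subr_eq0 => /eqP vE; have /andP[] := iso (diag_fun d *m v).
rewrite -vE; have -> : sqnorm (diag_fun d *m v) =
    \sum_i normc (d i) ^+ 2 * normc (v i 0) ^+ 2.
  by apply: eq_bigr => i _; rewrite diag_fun_mul normcMz exprMn.
move=> ge1 gek; split=> [|kap0]; apply: contrapT => /forallNP lt.
  move: ge1; rewrite leNgt => /negP; apply.
  have -> : sqnorm v = \sum_i 1 * normc (v i 0) ^+ 2.
    by apply: eq_bigr => i _; rewrite mul1r.
  apply: ltr_sum_sqnorm => // i; rewrite expr_lt1 ?normc_ge0 //.
  by have /negP := lt i; rewrite -ltNge.
move: gek; rewrite leNgt => /negP; apply; rewrite mulr_sumr.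
apply: ltr_sum_sqnorm => // i; rewrite ltr_pXn2r ?nnegrE ?normc_ge0 //.
by have /negP := lt i; rewrite -ltNge.
Qed.

(* The secular determinant in [w = exp (i z d)], for bond lengths [k i * d]. *)
Definition bond_poly S k : {poly C} :=
  \sum_A minor_coef S A *: 'X^(\sum_(i in A) k i).

Lemma bond_polyE S k w :
  (bond_poly S k).[w] = \det (1%:M - S *m diag_fun (fun i => w ^+ k i)).
Proof.
rewrite det_one_sub_diag horner_sum; apply: eq_bigr => A _.
by rewrite hornerZ hornerXn expr_sum.
Qed.

Variables (S : 'M[C]_n) (kap : R) (k : 'I_n -> nat) (m : nat).
Hypotheses (iso : quasi_isometry S kap) (kap1 : 1 <= kap)
  (m0 : (0 < m)%N) (mk : forall i, (m <= k i)%N).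

Lemma bond_poly_low : exists q, bond_poly S k = 1 + 'X^m * q.
Proof.
exists (\sum_(A | A != finset.set0) minor_coef S A *: 'X^(\sum_(i in A) k i - m)).
rewrite /bond_poly (bigD1 finset.set0) //= minor_coef0 big_set0 expr0 scale1r.
congr (_ + _); rewrite mulr_sumr; apply: eq_bigr => A /set0Pn[i iA].
rewrite -scalerAr -exprD subnKC // (bigD1 i) //=.
by rewrite (leq_trans (mk i)) // leq_addr.
Qed.

(** All [k i] are positive, so only the full set of bonds reaches the top exponent; its coefficient
    [\det (- S)] is nonzero because [S] is injective. *)
Lemma size_bond_poly : size (bond_poly S k) = (\sum_i k i).+1.
Proof.
rewrite /bond_poly (bigD1 finset.setT) //= minor_coefT.
have -> : (\sum_(i in (finset.setT : {set 'I_n})) k i = \sum_i k i)%N.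
  by apply: eq_bigl => i; rewrite inE.
rewrite size_polyDl size_scale ?size_polyXn ?(quasi_isometry_det iso) //.
rewrite ltnS; apply: (leq_trans (size_sum _ _ _)); apply/bigmax_leqP => A AT.
apply: (leq_trans (size_scale_leq _ _)); rewrite size_polyXn.
have [i iA] : exists i, i \notin A.
  by apply/existsP; rewrite -negb_forall; apply: contra AT => /forallP AA;
    apply/eqP/setP => i; rewrite AA inE.
rewrite [X in (_ <= X)%N](bigID (mem A)) /= -addn1 leq_add2l (bigD1 i) //=.
by rewrite (leq_trans _ (leq_addr _ _)) // (leq_trans m0).
Qed.

Lemma bond_poly_roots : exists rs : seq C,
  [/\ size rs = \sum_i k i,
   bond_poly S k = lead_coef (bond_poly S k) *: \prod_(w <- rs) ('X - w%:P),
   forall w, w \in rs -> 1 <= normc w /\ normc w ^+ m <= kap &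
   forall j, (0 < j < m)%N -> \sum_(w <- rs) w^-1 ^+ j = 0].
Proof.
set p := bond_poly S k; have [rs pE] := closed_field_poly_normal p.
have lc0 : lead_coef p != 0 by rewrite lead_coef_eq0 -size_poly_eq0 size_bond_poly.
have szrs : size rs = (\sum_i k i)%N.
  have := size_bond_poly; rewrite -/p pE size_scale // size_prod_XsubC => -[].
  by [].
have bnd w : w \in rs -> 1 <= normc w /\ normc w ^+ m <= kap.
  rewrite -root_prod_XsubC => rw.
  have : root p w by rewrite pE rootZ.
  rewrite rootE bond_polyE => /eqP/(secular_zero_size iso)[[i i1]].
  case/(_ (le_trans ler01 kap1)) => j jk; move: i1 jk; rewrite !normcX => i1 jk.
  (* Some power [|w|^(k i)] is at least 1, which forces [|w| >= 1]; then [|w|^m <= |w|^(k j) <= kap]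
     because [m <= k j]. *)
  have w1 : 1 <= normc w.
    by rewrite leNgt; apply: contraTN i1 => w1; rewrite -ltNge exprn_ilt1 ?normc_ge0 // gtn_eqF // (leq_trans m0).
  by split=> //; apply: le_trans jk; rewrite ler_weXn2l.
have rs0 w : w \in rs -> w != 0.
  by move=> /bnd[w1 _]; rewrite -normc_gt0 (lt_le_trans ltr01).
have p0 : p.[0] = 1.
  have [q pq] := bond_poly_low; rewrite /p pq.
  by rewrite hornerD hornerM hornerXn expr0n (gtn_eqF m0) mul0r addr0 -[1]/(1%:P) hornerC.
(* Since [p.[0] = 1], normalising at 0 instead of at infinity removes the scalar and brings in the
   inverse roots. *)
have pE1 : p = \prod_(w <- rs) (1 - w^-1 *: 'X).
  rewrite {1}pE; have -> : \prod_(w <- rs) ('X - w%:P) =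
      (\prod_(w <- rs) - w) *: \prod_(w <- rs) (1 - w^-1 *: 'X) :> {poly C}.
    rewrite -scaler_prod; apply: eq_big_seq => w wrs.
    by rewrite scalerBr scalerA mulNr mulfV ?rs0 // scaleN1r opprK scaleNr alg_polyC addrC.
  rewrite scalerA; have := p0; rewrite {1}pE hornerZ horner_prod.
  under eq_bigr do rewrite hornerXsubC sub0r.
  by move=> ->; rewrite scale1r.
exists rs; split=> // j jm; have [q pq] := bond_poly_low.
have := @power_sums_eq0 _ [seq w^-1 | w <- rs] m q j; rewrite !big_map.
by apply=> //; rewrite -pE1.
Qed.

End BondPolynomial.

(** * Counting the roots near 1 *)

Section RootCount.
Context {R : realType} {n : nat}.
Local Notation C := R[i].

Lemma sumr_le_count (T : eqType) (s : seq T) (P : pred T) (f : T -> R) (t : R) :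
  {in s, forall x, f x <= (P x)%:R * t} -> \sum_(x <- s) f x <= (count P s)%:R * t.
Proof.
move=> ft; rewrite -sum1_count natr_sum mulr_suml [leRHS]big_mkcond /=.
rewrite big_seq [leRHS]big_seq; apply: ler_sum => x /ft.
by case: (P x); rewrite ?mul0r.
Qed.

Lemma sqr_normc_inv_ge (w : C) (M : nat) (kap : R) : (0 < M)%N ->
  1 <= normc w -> normc w ^+ M.*2 <= kap -> 1 - normc w^-1 ^+ 2 <= ln kap / M%:R.
Proof.
move=> M0 w1 wk; have w0 : 0 < normc w by apply: lt_le_trans w1.
have a0 : 0 < normc w ^+ 2 by rewrite exprn_gt0.
have M1 : 0 < M%:R :> R by rewrite ltr0n.
rewrite normcV exprVn; have : 1 - ln (normc w ^+ 2) <= (normc w ^+ 2)^-1.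
  by rewrite -{2}(lnK a0) -expRN; apply: expR_ge1Dx.
suff : ln (normc w ^+ 2) <= ln kap / M%:R by lra.
rewrite ler_pdivlMr // mulr_natr -lnXn // -exprM mulnC muln2 in wk *.
by rewrite ler_ln ?posrE ?exprn_gt0 // (lt_le_trans _ wk) // exprn_gt0.
Qed.

Variables (S : 'M[C]_n) (kap : R) (k : 'I_n -> nat) (M : nat) (L h beta R2 : R).
Let d := L / M.*2%:R.
Let rho : R := 1 - d * h.
Let b := 2 * beta / L.
Let e := expR (- (h * L / 2)).
Let eta := 2 * e + e ^+ 2 + b * e.
Let y := h + ln kap / L.
Hypotheses (iso : quasi_isometry S kap) (kap1 : 1 <= kap) (M0 : (0 < M)%N)
  (Mk : forall i, (M.*2 <= k i)%N) (L0 : 0 < L) (h0 : 0 < h) (beta0 : 0 < beta)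
  (R20 : 0 < R2) (b1 : b <= 1) (dh : d * h < 1)
  (neg : beta * y + (1 - b) * (2 * y ^+ 2 / R2 - 1 + d * y) + eta <= 0).

(** The real part of the identity for [test_poly], multiplied by [d^2]: a root outside the window
    contributes at most 0, a root inside at most [beta / h + (1 - b + eta) / h^2]. The term [d * y]
    in the hypothesis [neg] disappears as [M] grows. *)
Lemma count_bond_poly_roots : exists rs : seq C,
  [/\ bond_poly S k = lead_coef (bond_poly S k) *: \prod_(w <- rs) ('X - w%:P),
   forall w, w \in rs -> 1 <= normc w &
   beta / 2 * (\sum_i (k i)%:R * d) <=
   (count (fun w => normc (1 - rho%:C * w^-1) ^+ 2 < d ^+ 2 * R2) rs)%:R
     * (beta / h + (1 - b + eta) / h ^+ 2)].
Proof.
have M20 : (0 < M.*2)%N by rewrite double_gt0.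
have [rs [szrs pE bnd pow]] := bond_poly_roots iso kap1 M20 Mk.
exists rs; split=> // [w /bnd[]//|].
have d0 : 0 < d by rewrite divr_gt0 // ltr0n.
have [mu muE] : exists mu : R, mu = M%:R by exists M%:R.
have M1 : 0 < mu by rewrite muE ltr0n.
have LE : L = 2 * mu * d.
  by rewrite muE /d -natrM mul2n mulrCA mulfV ?mulr1 // pnatr_eq0 -lt0n.
have szR : (size rs)%:R = (\sum_i k i)%N%:R :> R by rewrite szrs.
clear szrs pE; clearbody d; have ln0 : 0 <= ln kap by rewrite ln_ge0.
have y0 : 0 <= y by rewrite addr_ge0 ?(ltW h0) // divr_ge0 // (ltW L0).
(* At distance of order [d] from 1 this weight gives both kernels the size [d^-2], and
   [B / M = 2 beta / L] does not depend on [M]. *)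
pose B := beta / d.
have B0 : 0 <= B by rewrite divr_ge0 ?(ltW beta0) ?(ltW d0).
have bE : B / M%:R = b by rewrite /B /b -muE LE; field; lra.
have rho0 : 0 < rho by rewrite /rho subr_gt0.
have rho1 : rho < 1 by rewrite /rho gtrBl mulr_gt0.
have total : \sum_(w <- rs) complex.Re (test_poly M B).[rho%:C * w^-1] =
    B / 2 * (\sum_i k i)%:R.
  rewrite -Re_sum -(big_map (fun w => w^-1) xpredT
    (fun l => (test_poly M B).[rho%:C * l])) (sum_horner_power_sums (m := M.*2)).
  - by rewrite test_poly_at0 // size_map -[in LHS]mulr_natr mulrC
      -(rmorph_nat (real_complex R)) ReZ mulrC szR.
  - by move=> j jm; rewrite big_map pow.
  - exact: size_test_poly.
have le1 w : w \in rs -> normc (rho%:C * w^-1) <= rho.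
  move=> /bnd[w1 _]; rewrite normcMz normc_real gtr0_norm // normcV.
  by rewrite ler_piMr ?(ltW rho0) // invf_le1 // (lt_le_trans ltr01).
have lte w : w \in rs -> normc (rho%:C * w^-1) ^+ M <= e.
  move=> /le1 le_rho; apply: (@le_trans _ _ (rho ^+ M)).
    by rewrite lerXn2r ?nnegrE ?normc_ge0 // ltW.
  (* Here [M * d = L / 2], and [rho = 1 - d h <= exp (- d h)]. *)
  have -> : e = expR (- (d * h)) ^+ M.
    by rewrite -expRM_natl; congr expR; rewrite -mulr_natl -muE LE; field.
  rewrite lerXn2r ?nnegrE ?expR_ge0 ?(ltW rho0) //.
  by have := expR_ge1Dx (- (d * h)); rewrite /rho; lra.
have -> : beta / 2 * (\sum_i (k i)%:R * d) = d ^+ 2 * (B / 2 * (\sum_i k i)%:R).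
  rewrite -mulr_suml natr_sum /B; field; lra.
rewrite -total.
have dtop : beta / h + (1 - b + eta) / h ^+ 2 =
    d ^+ 2 * (B / (1 - rho) + (1 - b + eta) / (1 - rho) ^+ 2).
  by have -> : 1 - rho = d * h by [rewrite /rho; ring]; rewrite /B; field; rewrite !gt_eqF.
rewrite dtop mulrCA ler_pM2l ?exprn_gt0 //; apply: sumr_le_count => w wrs.
have w1 : normc (rho%:C * w^-1) < 1 by apply: le_lt_trans (le1 _ wrs) rho1.
have b1' : B / M%:R <= 1 by rewrite bE.
case: ltP => [_|out] /=.
  rewrite mul1r; have := Re_test_poly_le_max M0 B0 b1' w1 (lte _ wrs) (le1 _ wrs) rho1.
  by rewrite bE.
rewrite mul0r; apply: (Re_test_poly_le0 M0 B0 b1' w1 (lte _ wrs) R20 d0 y0 _ out).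
  (* With [s = |1 / w|^2], split [1 - rho^2 s] as [(1 - s) + (1 - rho^2) s]: the first part is at
     most [2 d (ln kap / L)], the second at most [2 d h]. *)
  have [wn wk] := bnd _ wrs; have := sqr_normc_inv_ge M0 wn wk.
  rewrite normcMz normc_real gtr0_norm // exprMn.
  have -> : ln kap / M%:R = 2 * d * (ln kap / L) by rewrite -muE LE; field; lra.
  have l1 : normc w^-1 ^+ 2 <= 1.
    by rewrite exprn_ile1 ?normc_ge0 // normcV invf_le1 // (lt_le_trans ltr01).
  have l0 : 0 <= normc w^-1 ^+ 2 by rewrite exprn_ge0 ?normc_ge0.
  have : (2 * d * h) * normc w^-1 ^+ 2 <= 2 * d * h.
    by rewrite ler_piMr // !mulr_ge0 ?(ltW d0) ?(ltW h0).
  have : 0 <= (d * h) ^+ 2 * normc w^-1 ^+ 2 by rewrite mulr_ge0 ?sqr_ge0.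
  rewrite /y /rho mulrDr; lra.
rewrite bE; have -> // : B * d * y = beta * y by rewrite /B; field; lra.
Qed.

End RootCount.

(** * From polynomials to exponential sums *)

Section CoefficientBounds.
Context {R : realType}.
Local Notation C := R[i].
Implicit Types (p q : {poly C}).

(* Replaces Rouche's theorem in the passage to the limit: dividing by ['X - x] at
   most doubles the l1 norm of the coefficients if [normc x <= 1 / 2]. *)
Lemma coef_prod_XsubC_small (xs : seq C) q (B e : R) (j : nat) :
  (forall x, x \in xs -> normc x <= e) -> e <= 1 / 2 -> 0 <= e -> 0 <= B ->
  (forall N, \sum_(k < N) normc ((\prod_(x <- xs) ('X - x%:P)) * q)`_k <= B) ->
  (j < size xs)%N ->
  normc ((\prod_(x <- xs) ('X - x%:P)) * q)`_j <= (size xs)%:R * e * 2 ^+ size xs * B.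
Proof.
move=> xe e2 e0; elim: xs j B xe => // x xs IH j B xe B0 lB jx.
rewrite big_cons -mulrA in lB *; set p := (\prod_(_ <- _) _) * q in lB *.
have xe' : normc x <= e by apply: xe; rewrite mem_head.
have coefE k : (('X - x%:P) * p)`_k = (if k is k'.+1 then p`_k' else 0) - x * p`_k.
  by rewrite mulrBl coefB coefXM coefCM; case: k.
have p_le (N : nat) : \sum_(k < N) normc p`_k <= 2 * B.
  (* The range is extended to the whole support of [p] so that shifting the index adds no term; then
     [|x| \sum_k |p_(k+1)|] is at most half of the sum being bounded and can be absorbed. *)
  pose K := maxn N (size p).
  have : \sum_(k < K) normc p`_k <= 2 * B.
    have := lB K.+1; rewrite big_ord_recl => le1.
    have le2 : \sum_(k < K) normc p`_k <=
        \sum_(k < K) normc (('X - x%:P) * p)`_(k.+1) + e * \sum_(k < K) normc p`_k.+1.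
      rewrite mulr_sumr -big_split /=; apply: ler_sum => k _; rewrite coefE.
      have -> : p`_k = (p`_k - x * p`_k.+1) + x * p`_k.+1 by rewrite subrK.
      apply: le_trans (normcD _ _) _; rewrite subrK lerD2l normcMz.
      by rewrite ler_wpM2r ?normc_ge0.
    have le3 : \sum_(k < K) normc p`_k.+1 <= \sum_(k < K) normc p`_k.
      have : \sum_(k < K.+1) normc p`_k = \sum_(k < K) normc p`_k.
        rewrite big_ord_recr /= nth_default ?normc0 ?addr0 //.
        by rewrite /K leq_maxr.
      rewrite big_ord_recl => <-; rewrite lerDr; exact: normc_ge0.
    have s0 : 0 <= \sum_(k < K) normc p`_k.
      by apply: sumr_ge0 => k _; exact: normc_ge0.
    have : e * \sum_(k < K) normc p`_k.+1 <= 1 / 2 * \sum_(k < K) normc p`_k.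
      apply: ler_pM => //; apply: sumr_ge0 => k _; exact: normc_ge0.
    have n0 := normc_ge0 (('X - x%:P) * p)`_(@ord0 K).
    lra.
  apply: le_trans; rewrite -(big_mkord xpredT (fun k => normc p`_k)).
  rewrite -(big_mkord xpredT (fun k => normc p`_k)).
  rewrite [leRHS](big_cat_nat (n := N)) ?leq_maxl //= lerDl.
  by apply: sumr_ge0 => k _; exact: normc_ge0.
have pj k : normc p`_k <= 2 * B.
  apply: le_trans (p_le k.+1); rewrite big_ord_recr /= lerDr.
  by apply: sumr_ge0 => i _; exact: normc_ge0.
have xp : normc (x * p`_j) <= e * (2 * B).
  by rewrite normcMz ler_pM ?normc_ge0.
have IH' : forall k, (k < size xs)%N ->
    normc p`_k <= (size xs)%:R * e * 2 ^+ size xs * (2 * B).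
  move=> k kx; apply: IH => //; last by rewrite mulr_ge0.
  by move=> y yxs; apply: xe; rewrite inE yxs orbT.
have big : e * (2 * B) <= e * 2 ^+ (size xs).+1 * B.
  rewrite -!mulrA ler_wpM2l // ler_wpM2r // exprS ler_peMr //.
  by rewrite exprn_ege1 // ler1n.
have -> : (size (x :: xs))%:R * e * 2 ^+ size (x :: xs) * B =
    (size xs)%:R * e * 2 ^+ size xs * (2 * B) + e * 2 ^+ (size xs).+1 * B.
  by rewrite /= -natr1 exprS; ring.
rewrite coefE; case: j jx xp => [|j] jx xp.
  rewrite sub0r normcNz; apply: le_trans (le_trans xp big) _; rewrite lerDr.
  by rewrite !mulr_ge0 // exprn_ge0.
by apply: le_trans (normcB _ _) _; apply: lerD (IH' _ jx) (le_trans xp big).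
Qed.

Lemma coef_affine_exp (t s : C) m j :
  ((t%:P + s *: 'X) ^+ m)`_j = t ^+ (m - j) * s ^+ j *+ 'C(m, j).
Proof.
rewrite exprDn coef_sum.
under eq_bigr => i _.
  rewrite coefMn -polyC_exp exprZn coefCM coefZ coefXn; over.
case: (leqP j m) => jm; last first.
  rewrite bin_small // mulr0n big1 // => i _.
  by rewrite (_ : _ == _ = false) ?mulr0 ?mul0rn // gtn_eqF // (leq_ltn_trans _ jm) // -ltnS ltn_ord.
rewrite (bigD1 (inord j)) //= inordK ?ltnS // eqxx mulr1 big1 ?addr0 // => i ij.
rewrite (_ : _ == _ = false) ?mulr0 ?mul0rn //; apply: contraNF ij => /eqP ji.
by apply/eqP/val_inj; rewrite /= inordK // ltnS.
Qed.

Lemma l1_affine_exp (t s : C) m N :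
  \sum_(k < N) normc ((t%:P + s *: 'X) ^+ m)`_k <= (normc t + normc s) ^+ m.
Proof.
elim: m N => [|m IH] N.
  rewrite !expr0; case: N => [|N]; first by rewrite big_ord0.
  rewrite big_ord_recl coef1 normc1 big1 ?addr0 // => i _.
  by rewrite coef1 normc0.
set p := (_ + _) ^+ m in IH *.
have -> : (t%:P + s *: 'X) ^+ m.+1 = t *: p + s *: ('X * p).
  by rewrite exprS -/p mulrDl mul_polyC scalerAl.
apply: (@le_trans _ _ (\sum_(k < N) (normc t * normc p`_k + normc s * normc ('X * p)`_k))).
  apply: ler_sum => k _; rewrite coefD !coefZ -!normcMz; exact: normcD.
rewrite big_split /= -!mulr_sumr exprS mulrDl; apply: lerD.
  by apply: ler_wpM2l; [exact: normc_ge0|exact: IH].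
rewrite ler_wpM2l ?normc_ge0 //; case: N => [|N].
  by rewrite big_ord0 exprn_ge0 // addr_ge0 ?normc_ge0.
rewrite big_ord_recl (_ : normc _ = 0) ?add0r; last by rewrite coefXM normc0.
by apply: le_trans (IH N); apply: ler_sum => k _; rewrite coefXM.
Qed.

End CoefficientBounds.

Section ExponentialLimits.
Context {R : realType}.
Local Notation C := R[i].
Implicit Types (z : C) (F : set_system nat).

Lemma cvg_normc (T : Type) (F : set_system T) {FF : Filter F} (u : T -> C^o) (l : C^o) (v : T -> R) :
  (\forall n \near F, normc (u n - l) <= v n) -> v @ F --> (0 : R) -> u @ F --> l.
Proof.
move=> uv v0; apply/cvgrPdist_lt => e e0.
have [eI eR] : complex.Im e = 0 /\ 0 < complex.Re e.
  by move: e0; rewrite ltcE => /andP[/eqP -> ->].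
have eE : e = (complex.Re e)%:C by case: e eI {e0 eR} => a b /= ->.
have v_lt : \forall n \near F, `|0 - v n| < complex.Re e.
  by move/cvgrPdist_lt: v0; apply.
apply: filterS2 uv v_lt => n un; rewrite sub0r normrN => vn.
rewrite eE normrC_normc ltcR normc_distC; apply: le_lt_trans un _.
by apply: le_lt_trans vn; exact: ler_norm.
Qed.

Lemma normc_exp_sub_le (a b : C) (m : nat) (B : R) :
  1 <= B -> normc a <= B -> normc b <= B ->
  normc (a ^+ m - b ^+ m) <= normc (a - b) * (m%:R * B ^+ m).
Proof.
move=> B1 aB bB; have B0 : 0 <= B by apply: le_trans B1.
rewrite subrXX normcMz; apply: ler_wpM2l; first exact: normc_ge0.
apply: le_trans (normc_sum _ _ _) _.
have -> : m%:R * B ^+ m = \sum_(i < m) B ^+ m.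
  by rewrite sumr_const card_ord mulr_natl.
apply: ler_sum => i _; rewrite normcMz !normcX.
apply: (@le_trans _ _ (B ^+ (m.-1 - i) * B ^+ i)).
  by apply: ler_pM; rewrite ?exprn_ge0 ?normc_ge0 // lerXn2r ?nnegrE ?normc_ge0.
by rewrite -exprD ler_weXn2l // subnK ?leq_pred // -ltnS prednK ?ltn_ord // (leq_ltn_trans _ (ltn_ord i)).
Qed.

(** Pass through [exp (i d z)^m]. The first difference is at most [m] times a Taylor error of order
    [d^2], hence of order [d] while [d m] stays bounded; the second is the Taylor error of
    [exp (i z (d m - l))]. *)
Lemma normc_affine_exp_sub_le (d l : R) z m :
  0 <= d -> d * normc z <= 1 / 2 -> normc z * `|d * m%:R - l| <= 1 / 2 ->
  normc ((1 + 'i%C * d%:C * z) ^+ m - cexp ('i%C * z * l%:C)) <=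
  8 * (d * normc z) * (d * m%:R * normc z) * expR (d * m%:R * normc z)
  + expR (normc z * `|l|) *
    (normc z * `|d * m%:R - l| + 8 * (normc z * `|d * m%:R - l|) ^+ 2).
Proof.
move=> d0 dz tau_le; set u := 'i%C * d%:C * z.
have ni : normc 'i%C = 1 :> R by rewrite /= expr0n expr1n add0r sqrtr1.
have nu : normc u = d * normc z.
  by rewrite !normcMz ni normc_real mul1r ger0_norm.
have Ez : cexp u ^+ m = cexp ('i%C * z * (d * m%:R)%:C).
  rewrite -cexpMn; congr cexp; rewrite /u -[LHS]mulr_natr rmorphM /= rmorph_nat; ring.
rewrite -[_ - _](subrKA (cexp u ^+ m)); apply: le_trans (normcD _ _) _; apply: lerD.
  have eB : 1 <= expR (normc u) by rewrite -expR0 ler_expR normc_ge0.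
  apply: le_trans (normc_exp_sub_le (B := expR (normc u)) m eB _ _) _.
  - apply: le_trans (normcD _ _) _; rewrite normc1; exact: expR_ge1Dx.
  - rewrite normc_cexp ler_expR; apply: le_trans (normc_ge_absRe _); exact: ler_norm.
  have -> : 1 + u - cexp u = - (cexp u - 1 - u) by ring.
  rewrite normcNz -expRM_natl nu.
  have -> : 8 * (d * normc z) * (d * m%:R * normc z) * expR (d * m%:R * normc z) =
     8 * (d * normc z) ^+ 2 * (m%:R * expR (d * m%:R * normc z)) by ring.
  have -> : m%:R * (d * normc z) = d * m%:R * normc z by ring.
  apply: ler_wpM2r; first by rewrite mulr_ge0 ?expR_ge0.
  by rewrite -nu cexp_taylor1 // nu.
rewrite Ez; set tau := normc z * _ in tau_le *.
have -> : 'i%C * z * (d * m%:R)%:C = 'i%C * z * l%:C + 'i%C * z * (d * m%:R - l)%:C.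
  by rewrite rmorphB /=; ring.
set w := 'i%C * z * (_ - _)%:C.
have nw : normc w = tau by rewrite !normcMz ni normc_real mul1r.
rewrite cexpD; have -> : cexp ('i%C * z * l%:C) * cexp w - cexp ('i%C * z * l%:C) =
   cexp ('i%C * z * l%:C) * (w + (cexp w - 1 - w)) by ring.
rewrite normcMz normc_cexp; apply: ler_pM; [exact: expR_ge0|exact: normc_ge0| |].
  rewrite ler_expR; apply: le_trans (ler_norm _) (le_trans (normc_ge_absRe _) _).
  by rewrite !normcMz ni normc_real mul1r.
apply: le_trans (normcD _ _) _; rewrite nw lerD2l -nw cexp_taylor1 //.
by rewrite nw.
Qed.

Lemma cvg_affine_exp F {FF : Filter F} z (d : nat -> R) (m : nat -> nat) (l : R) :
  (\forall n \near F, 0 <= d n) -> d @ F --> (0 : R) ->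
  (fun n => d n * (m n)%:R) @ F --> l ->
  (fun n => (1 + 'i%C * (d n)%:C * z) ^+ m n : C^o) @ F --> (cexp ('i%C * z * l%:C) : C^o).
Proof.
move=> d0 dc ml.
have dz : (fun n => d n * normc z) @ F --> (0 : R).
  by rewrite -[0](mul0r (normc z)); apply: cvgM => //; apply: cvg_cst.
have mz : (fun n => d n * (m n)%:R * normc z) @ F --> l * normc z.
  by apply: cvgM => //; apply: cvg_cst.
have tau : (fun n => normc z * `|d n * (m n)%:R - l|) @ F --> (0 : R).
  rewrite -[0](mulr0 (normc z)); apply: cvgM; first exact: cvg_cst.
  rewrite -(@normr0 _ R) -(subrr l); apply: cvg_norm; apply: cvgB => //; exact: cvg_cst.
have ez : (fun n => expR (d n * (m n)%:R * normc z)) @ F --> expR (l * normc z).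
  by apply: (cvg_comp _ _ mz); exact: continuous_expR.
apply: (cvg_normc (v := fun n =>
  8 * (d n * normc z) * (d n * (m n)%:R * normc z) * expR (d n * (m n)%:R * normc z)
  + expR (normc z * `|l|) * (normc z * `|d n * (m n)%:R - l|
    + 8 * (normc z * `|d n * (m n)%:R - l|) ^+ 2))).
  have h1 : \forall n \near F, d n * normc z <= 1 / 2.
    move/cvgrPdist_le: dz => /(_ (1 / 2)) dz.
    by apply: filterS (dz _) => [n|]; rewrite ?sub0r ?normrN ?divr_gt0 //; apply: le_trans; exact: ler_norm.
  have h2 : \forall n \near F, normc z * `|d n * (m n)%:R - l| <= 1 / 2.
    move/cvgrPdist_le: tau => /(_ (1 / 2)) dz'.
    by apply: filterS (dz' _) => [n|]; rewrite ?sub0r ?normrN ?divr_gt0 //; apply: le_trans; exact: ler_norm.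
  by apply: filterS3 d0 h1 h2 => n; exact: normc_affine_exp_sub_le.
have -> : (0 : R) = 8 * 0 * (l * normc z) * expR (l * normc z)
    + expR (normc z * `|l|) * (0 + 8 * (0 * 0)) by ring.
apply: cvgD; first by do 3 (apply: cvgM => //); exact: cvg_cst.
apply: cvgM; first exact: cvg_cst.
apply: cvgD => //; apply: cvgM; first exact: cvg_cst.
by apply: cvgM.
Qed.

Lemma cvg_scaled_ffact F {FF : Filter F} (d : nat -> R) (m : nat -> nat) (l : R) j :
  d @ F --> (0 : R) -> (fun n => d n * (m n)%:R) @ F --> l ->
  (\forall n \near F, 0 <= d n) ->
  (fun n => d n * (m n - j)%N%:R) @ F --> l /\
  (fun n => d n ^+ j * ((m n) ^_ j)%:R) @ F --> l ^+ j.
Proof.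
move=> dc ml d0.
have sub i : (fun n => d n * (m n - i)%N%:R) @ F --> l.
  have lo : (fun n => d n * (m n)%:R - d n * i%:R) @ F --> l.
    rewrite -[l]subr0 -[0](mul0r (i%:R)); apply: cvgB => //.
    by apply: cvgM => //; exact: cvg_cst.
  apply: squeeze_cvgr lo ml; apply: filterS d0 => n d0.
  rewrite -mulrBr; apply/andP; split; apply: ler_wpM2l => //.
    by rewrite lerBlDr -natrD ler_nat addnC -leq_subLR.
  by rewrite ler_nat leq_subr.
split=> //; elim: j => [|j IH].
  under eq_fun do rewrite expr0 ffactn0 mul1r; exact: cvg_cst.
have -> : (fun n => d n ^+ j.+1 * (m n ^_ j.+1)%:R) =
    (fun n => (d n ^+ j * (m n ^_ j)%:R) * (d n * (m n - j)%N%:R)).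
  by apply/funext => n; rewrite ffactnSr natrM exprS; ring.
by rewrite exprSr; apply: cvgM.
Qed.

(** The limit is the Taylor coefficient of index [j] of [exp (i z l)] at [z]. Convergence of all
    coefficients is what carries multiplicities to the limit. *)
Lemma cvg_coef_affine_exp F {FF : Filter F} (d : nat -> R) (m : nat -> nat) (l : R) z j :
  (\forall n \near F, 0 <= d n) -> d @ F --> (0 : R) ->
  (fun n => d n * (m n)%:R) @ F --> l ->
  (fun n => (((1 + 'i%C * (d n)%:C * z)%:P + ('i%C * (d n)%:C) *: 'X) ^+ m n)`_j : C^o)
    @ F --> (cexp ('i%C * z * l%:C) * ('i%C * l%:C) ^+ j / (j`!)%:R : C^o).
Proof.
move=> d0 dc ml; have [mj fj] := cvg_scaled_ffact j dc ml d0.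
have ac := @cvg_affine_exp F FF z d _ l d0 dc mj.
have rc : (fun n => (d n ^+ j * (m n ^_ j)%:R)%:C : C^o) @ F --> ((l ^+ j)%:C : C^o).
  apply: (cvg_normc (v := fun n => `|d n ^+ j * (m n ^_ j)%:R - l ^+ j|)).
    by apply: nearW => n; rewrite -rmorphB normc_real.
  rewrite -(@normr0 _ R) -(subrr (l ^+ j)); apply: cvg_norm; apply: cvgB => //; exact: cvg_cst.
have jf : (j`!)%:R != 0 :> C by rewrite pnatr_eq0 -lt0n fact_gt0.
have -> : (fun n => (((1 + 'i%C * (d n)%:C * z)%:P + ('i%C * (d n)%:C) *: 'X) ^+ m n)`_j : C^o)
  = (fun n => (1 + 'i%C * (d n)%:C * z) ^+ (m n - j) * (d n ^+ j * (m n ^_ j)%:R)%:C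
       * ('i%C ^+ j / (j`!)%:R) : C^o).
  apply/funext => n; rewrite coef_affine_exp -bin_ffact natrM rmorphM /=.
  rewrite rmorphXn rmorphM /= !rmorph_nat -mulr_natr exprMn.
  by field.
have -> : cexp ('i%C * z * l%:C) * ('i%C * l%:C) ^+ j / (j`!)%:R =
  cexp ('i%C * z * l%:C) * (l ^+ j)%:C * ('i%C ^+ j / (j`!)%:R) :> C.
  by rewrite exprMn rmorphXn /=; field.
exact: (cvgM (cvgM ac rc) (cvg_cst _)).
Qed.

End ExponentialLimits.

(** * Convergence of the rescaled roots *)

Section LimitZeros.
Context {R : realType} {n : nat}.
Local Notation C := R[i].

Lemma ultra_cvg_segment (F : set_system nat) (FU : UltraFilter F) (u : nat -> R) (Z : R) :
  (\forall N \near F, `|u N| <= Z) -> exists l : R, u @ F --> l.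
Proof.
move=> uZ; have FP : ProperFilter F := @ultra_proper _ F FU.
have [|l [_ lc]] := @segment_compact R (- Z) Z (u @ F) _.
  by apply: filterS uZ => N; rewrite /= in_itv /= ler_norml.
exists l => U lU; have [//|UC] := in_ultra_setVsetC (u @^-1` U) FU.
by have [x [Ux nUx]] := lc (~` U) U UC lU; case: Ux.
Qed.

(* Lengths are rounded up to multiples of [d]; the [.+1] keeps this valid when
   [len i] already is one, at the cost of one more [d]. *)
Definition bond_count (d : R) (len : 'I_n -> R) (i : 'I_n) : nat :=
  (Num.truncn (len i / d)).+1.

Lemma bond_count_bounds d len i : 0 < d -> 0 <= len i ->
  len i <= d * (bond_count d len i)%:R <= len i + d.
Proof.
move=> d0 l0; have /truncn_itv/andP[lo hi] : 0 <= len i / d by rewrite divr_ge0 // ltW.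
rewrite /bond_count; apply/andP; split.
  by move: hi; rewrite ltr_pdivrMr // mulrC => /ltW.
by rewrite -natr1 mulrDr mulr1 lerD2r mulrC -ler_pdivlMr.
Qed.

Variables (c : {set 'I_n} -> C) (len : 'I_n -> R) (L h A : R) (n0 M1 : nat).
Hypotheses (len0 : forall i, 0 <= len i) (L0 : 0 < L) (h0 : 0 < h) (A0 : 0 <= A).

Let d (M : nat) : R := L / M.*2%:R.
Let R2 := A ^+ 2 + h ^+ 2.
Let k M : 'I_n -> nat := bond_count (d M) len.
Let P M : {poly C} := \sum_B c B *: 'X^(\sum_(i in B) k M i).
Let ell (B : {set 'I_n}) : R := \sum_(i in B) len i.

Hypothesis roots : forall M, (M1 <= M)%N -> exists rs : seq C,
  [/\ P M = lead_coef (P M) *: \prod_(w <- rs) ('X - w%:P),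
   forall w, w \in rs -> 1 <= normc w &
   (n0 <= count (fun w => (normc (1 - (1 - d M * h)%:C * w^-1) ^+ 2 < d M ^+ 2 * R2)%R) rs)%N].

Let d_cvg : d @ \oo --> (0 : R).
Proof.
have -> : d = (fun M => L / 2 * M%:R^-1).
  by apply/funext => M; rewrite /d -muln2 natrM invfM mulrA mulrAC.
rewrite -[0](mulr0 (L / 2)); apply: cvgM; first exact: cvg_cst.
rewrite -(cvg_shiftS (fun M => M%:R^-1 : R)); exact: cvg_harmonic.
Qed.

Let d_gt0 M : (0 < M)%N -> 0 < d M.
Proof. by move=> M0; rewrite divr_gt0 // ltr0n double_gt0. Qed.

(** Exactly [n0] roots are kept for every [M], so that each index in ['I_n0] defines a sequence of
    roots. *)
Let selected_roots : exists W : nat -> seq C, forall M, (M1 <= M)%N ->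
  [/\ size (W M) = n0, exists q, P M = (\prod_(w <- W M) ('X - w%:P)) * q &
   forall w, w \in W M -> 1 <= normc w /\
     normc (1 - (1 - d M * h)%:C * w^-1) ^+ 2 < d M ^+ 2 * R2].
Proof.
suff H M : exists W : seq C, (M1 <= M)%N -> [/\ size W = n0,
    exists q, P M = (\prod_(w <- W) ('X - w%:P)) * q &
    forall w, w \in W -> 1 <= normc w /\
      normc (1 - (1 - d M * h)%:C * w^-1) ^+ 2 < d M ^+ 2 * R2].
  by have [W WP] := choice H; exists W.
have [M1M|M1M] := boolP (M1 <= M)%N; last by exists [::].
have [rs [PE rs1 cnt]] := roots M1M.
pose p : pred C := fun w => normc (1 - (1 - d M * h)%:C * w^-1) ^+ 2 < d M ^+ 2 * R2.
have {}cnt : (n0 <= count p rs)%N by exact: cnt.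
exists (take n0 (seq.filter p rs)) => _; split.
- by rewrite size_takel // size_filter.
- exists ((\prod_(w <- drop n0 (seq.filter p rs)) ('X - w%:P)) *
    (lead_coef (P M) *: \prod_(w <- rs | ~~ p w) ('X - w%:P))).
  rewrite mulrA -big_cat cat_take_drop big_filter {1}PE.
  by rewrite -scalerAr (bigID p).
- by move=> w /mem_take; rewrite mem_filter => /andP[pw /rs1 w1].
Qed.

(** The chart [w = 1 + i d z] is affine, not logarithmic, so that [P M] stays a polynomial in it. Up
    to errors of order [d], it turns the window into the disc [|i z + h|^2 <= R2] and [|w| >= 1]
    into [Im z <= 0]. *)
Let root_location (dM : R) (w : C) : 0 < dM -> dM * h < 1 ->
  dM * Num.sqrt R2 <= 1 / 2 -> 1 <= normc w ->
  normc (1 - (1 - dM * h)%:C * w^-1) ^+ 2 < dM ^+ 2 * R2 ->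
  let z := (w - 1) / ('i%C * dM%:C) in
  let Z := 2 * Num.sqrt R2 + h in
  [/\ normc z <= Z,
      complex.Re z ^+ 2 + (h - complex.Im z) ^+ 2 <= R2 * (1 + dM * Z) ^+ 2 &
      2 * complex.Im z <= dM * Z ^+ 2].
Proof.
move=> d0 dh dR w1 lt z Z; set r := Num.sqrt R2 in dR Z *.
have R20 : 0 < R2 by rewrite /R2 ltr_wpDl ?sqr_ge0 // exprn_gt0.
have r2 : r ^+ 2 = R2 by rewrite sqr_sqrtr // ltW.
have r0 : 0 <= r by exact: sqrtr_ge0.
have w0 : 0 < normc w by apply: lt_le_trans w1.
have wn0 : w != 0 by rewrite -normc_gt0.
have ni : normc 'i%C = 1 :> R by rewrite /= expr0n expr1n add0r sqrtr1.
have i0 : 'i%C != 0 :> C by rewrite -normc_gt0 ni ltr01.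
have dC : dM%:C != 0 :> C by rewrite -normc_gt0 normc_real normr_gt0 gt_eqF.
have near : normc (w - (1 - dM * h)%:C) <= dM * r * normc w.
  have -> : w - (1 - dM * h)%:C = (1 - (1 - dM * h)%:C * w^-1) * w by field.
  rewrite normcMz ler_pM2r //.
  rewrite -(ler_pXn2r (n := 2)) ?nnegrE ?normc_ge0 ?mulr_ge0 ?(ltW d0) //.
  by rewrite exprMn r2 ltW.
have w2 : normc w <= 2.
  have : normc w <= dM * r * normc w + (1 - dM * h).
    rewrite -{1}(subrK (1 - dM * h)%:C w); apply: le_trans (normcD _ _) _.
    by rewrite lerD // normc_real ger0_norm // subr_ge0 ltW.
  have : dM * r * normc w <= 1 / 2 * normc w by rewrite ler_wpM2r ?normc_ge0.
  have : 0 < dM * h by rewrite mulr_gt0.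
  by lra.
have wE : w = 1 + 'i%C * dM%:C * z by rewrite /z; field; apply/andP.
have zh : normc ('i%C * z + h%:C) <= r * normc w.
  suff e : dM * normc ('i%C * z + h%:C) = normc (w - (1 - dM * h)%:C).
    by rewrite -(ler_pM2l d0) e mulrA.
  rewrite -{1}(gtr0_norm d0) -normc_real -normcMz; congr normc.
  by rewrite [in RHS]wE rmorphB rmorph1 rmorphM /=; ring.
have zZ : normc z <= Z.
  have -> : normc z = normc ('i%C * z + h%:C - h%:C) by rewrite addrK normcMz ni mul1r.
  apply: le_trans (normcB _ _) _; rewrite normc_real gtr0_norm // lerD2r.
  by apply: le_trans zh _; rewrite mulrC ler_wpM2r.
have w1Z : normc w <= 1 + dM * Z.
  rewrite {1}wE; apply: le_trans (normcD _ _) _; rewrite normc1 lerD2l normcMz normcMz ni mul1r.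
  by rewrite normc_real gtr0_norm // ler_wpM2l // ltW.
split=> //.
  have -> : complex.Re z ^+ 2 + (h - complex.Im z) ^+ 2 = normc ('i%C * z + h%:C) ^+ 2.
    by rewrite sqr_normc_ReIm; case: (z) => x y /=; ring.
  rewrite -r2 -exprMn; apply: ler_sqr_ge0; first exact: normc_ge0.
  by apply: le_trans zh _; rewrite ler_wpM2l.
have zz := sqr_normc_ReIm z.
have : 1 <= normc w ^+ 2 by rewrite exprn_ege1.
rewrite wE; have -> : normc (1 + 'i%C * dM%:C * z) ^+ 2 =
    1 - 2 * dM * complex.Im z + dM ^+ 2 * normc z ^+ 2.
  by rewrite zz sqr_normc_ReIm; case: (z) => x y /=; ring.
have zZ2 : normc z ^+ 2 <= Z ^+ 2 by apply: ler_sqr_ge0 => //; exact: normc_ge0.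
move=> ge; rewrite -(ler_pM2l d0).
have : dM ^+ 2 * normc z ^+ 2 <= dM ^+ 2 * Z ^+ 2 by rewrite ler_wpM2l ?sqr_ge0.
rewrite expr2; lra.
Qed.

Let ell_cvg (B : {set 'I_n}) :
  (fun M => d M * (\sum_(i in B) k M i)%N%:R) @ \oo --> ell B.
Proof.
have hi : (fun M => ell B + n%:R * d M) @ \oo --> ell B.
  rewrite -[X in _ --> X]addr0 -(mulr0 n%:R).
  exact: (cvgD (cvg_cst _) (cvgM (cvg_cst _) d_cvg)).
apply: squeeze_cvgr (cvg_cst (ell B)) hi; near=> M.
have M0 : (0 < M)%N by near: M; exists 1%N.
have dM0 := d_gt0 M0; rewrite natr_sum mulr_sumr /cst; apply/andP; split.
  by apply: ler_sum => i _; case/andP: (bond_count_bounds dM0 (len0 i)).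
apply: (@le_trans _ _ (\sum_(i in B) (len i + d M))).
  by apply: ler_sum => i _; case/andP: (bond_count_bounds dM0 (len0 i)).
rewrite big_split /= lerD2l sumr_const -[leLHS]mulr_natl.
apply: ler_wpM2r; [exact: ltW|rewrite ler_nat].
by rewrite -[leqRHS]card_ord max_card.
Unshelve. all: by end_near.
Qed.

(** [P M] in the local coordinate [X] of the chart [w = 1 + i d (zeta + X)]: a root [1 + i d z] of
    [P M] becomes the root [z - zeta]. *)
Let shifted M (zeta : C) : {poly C} :=
  \sum_B c B *: ((1 + 'i%C * (d M)%:C * zeta)%:P + ('i%C * (d M)%:C) *: 'X)
    ^+ (\sum_(i in B) k M i).

Let shiftedE M zeta :
  P M \Po ((1 + 'i%C * (d M)%:C * zeta)%:P + ('i%C * (d M)%:C) *: 'X) = shifted M zeta.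
Proof.
rewrite /P (rmorph_sum (comp_poly _)) /=; apply: eq_bigr => B _.
by rewrite comp_polyZ comp_Xn_poly.
Qed.

(** Each power has norm at most [(1 + d (|zeta| + 1))^m <= exp (d m (|zeta| + 1))], and [d m]
    converges. This is the uniform bound that [coef_prod_XsubC_small] requires. *)
Let shifted_l1 zeta : exists2 K : R, 0 <= K & \forall M \near \oo, forall N,
  \sum_(j < N) normc (shifted M zeta)`_j <= K.
Proof.
have ni : normc 'i%C = 1 :> R by rewrite /= expr0n expr1n add0r sqrtr1.
exists (\sum_B normc (c B) * expR ((ell B + 1) * (normc zeta + 1))).
  by apply: sumr_ge0 => B _; rewrite mulr_ge0 ?normc_ge0 ?expR_ge0.
have near_ell : \forall M \near \oo, forall B : {set 'I_n}, d M * (\sum_(i in B) k M i)%N%:R <= ell B + 1.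
  apply: filter_forall => B; move/cvgrPdist_le: (ell_cvg (B := B)) => /(_ _ ltr01).
  apply: filterS => M; rewrite ler_norml => /andP[lo _]; lra.
have M0 : \forall M \near \oo, (0 < M)%N by exists 1%N.
apply: filterS2 M0 near_ell => M M0 Mell N.
have dM0 := d_gt0 M0.
apply: (@le_trans _ _ (\sum_(j < N) \sum_B normc (c B) *
    normc (((1 + 'i%C * (d M)%:C * zeta)%:P + ('i%C * (d M)%:C) *: 'X)
    ^+ (\sum_(i in B) k M i))`_j)).
  apply: ler_sum => j _; rewrite coef_sum; apply: le_trans (normc_sum _ _ _) _.
  by apply: ler_sum => B _; rewrite coefZ normcMz.
rewrite exchange_big /=; apply: ler_sum => B _; rewrite -mulr_sumr.
apply: ler_wpM2l; first exact: normc_ge0.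
apply: le_trans (l1_affine_exp _ _ _ _) _.
apply: (@le_trans _ _ (expR (d M * (normc zeta + 1)) ^+ (\sum_(i in B) k M i))).
  rewrite lerXn2r ?nnegrE ?addr_ge0 ?normc_ge0 ?expR_ge0 //.
  apply: le_trans (expR_ge1Dx _); apply: (@le_trans _ _ (1 + d M * normc zeta + d M)); last by lra.
  apply: lerD; last by rewrite normcMz ni mul1r normc_real gtr0_norm.
  apply: le_trans (normcD _ _) _; rewrite normc1 !normcMz ni mul1r normc_real gtr0_norm //.
rewrite -expRM_natl ler_expR mulrCA mulrA ler_wpM2r //.
by rewrite addr_ge0 ?normc_ge0.
Qed.

Let shifted_coef_cvg F (FF : Filter F) (Foo : \oo `<=` F) zeta j :
  (fun M => (shifted M zeta)`_j : C^o) @ F -->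
  (\sum_B c B * (cexp ('i%C * zeta * (ell B)%:C) * ('i%C * (ell B)%:C) ^+ j / (j`!)%:R) : C^o).
Proof.
have -> : (fun M => (shifted M zeta)`_j : C^o) = (fun M => \sum_B c B *
    (((1 + 'i%C * (d M)%:C * zeta)%:P + ('i%C * (d M)%:C) *: 'X) ^+ (\sum_(i in B) k M i))`_j).
  by apply/funext => M; rewrite coef_sum; apply: eq_bigr => B _; rewrite coefZ.
apply: cvg_big => [|B _]; first exact: add_continuous.
apply: cvgM; first exact: cvg_cst.
apply: cvg_coef_affine_exp.
- by apply: Foo; exists 1%N => // M /= M0; rewrite ltW // d_gt0.
- exact: (cvg_trans (cvg_app _ Foo) d_cvg).
- exact: (cvg_trans (cvg_app _ Foo) (ell_cvg (B := B))).
Qed.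

(** If [m] of the limits equal [zeta], the shifted polynomial is divisible by [m] factors [X - x]
    with [x] tending to 0, so its coefficients of index below [m] tend to 0. They also tend to the
    Taylor coefficients of the exponential sum at [zeta]. *)
Lemma limit_zeros : exists zs : 'I_n0 -> C,
  (forall i, `|complex.Re (zs i)| <= A) /\
  (forall zeta j, (j < #|[pred i | zs i == zeta]|)%N ->
    \sum_B c B * (('i%C * (ell B)%:C) ^+ j * cexp ('i%C * zeta * (ell B)%:C)) = 0).
Proof.
have [W WP] := selected_roots.
(* Along an ultrafilter every bounded real sequence converges, so all roots converge at once without
   extracting subsequences. *)
have [F [FU Foo]] := @ultraFilterLemma nat \oo _.
have FP : ProperFilter F := @ultra_proper _ F FU.
pose z M (i : 'I_n0) : C := ((W M)`_i - 1) / ('i%C * (d M)%:C).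
pose Z := 2 * Num.sqrt R2 + h.
have FM : \forall M \near F, (M1 <= M)%N /\ (0 < M)%N.
  by apply: Foo; exists (maxn M1 1) => // M /=; rewrite geq_max => /andP[].
have dF : d @ F --> (0 : R) := cvg_trans (cvg_app _ Foo) d_cvg.
have small (x : R) : 0 < x -> \forall M \near F, d M * x <= 1 / 2.
  move=> x0; move/cvgrPdist_le: dF => /(_ (1 / 2 / x)).
  move=> H; have {H} := H (divr_gt0 (divr_gt0 ltr01 (ltr0n _ 2)) x0).
  apply: filterS => M; rewrite sub0r normrN -ler_pdivlMr // => /(le_trans _); apply.
  exact: ler_norm.
have R20 : 0 < R2 by rewrite /R2 ltr_wpDl ?sqr_ge0 // exprn_gt0.
have loc : \forall M \near F, forall i : 'I_n0,
  [/\ normc (z M i) <= Z, complex.Re (z M i) ^+ 2 + (h - complex.Im (z M i)) ^+ 2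
      <= R2 * (1 + d M * Z) ^+ 2 & 2 * complex.Im (z M i) <= d M * Z ^+ 2].
  have s1 := small _ h0.
  have s2 : \forall M \near F, d M * Num.sqrt R2 <= 1 / 2 by apply: small; rewrite sqrtr_gt0.
  apply: filterS3 FM s1 s2 => M [M1M M0] s1 s2 i.
  have [sz _ WM] := WP M M1M.
  have [|w1 wd] := WM (W M)`_i; first by rewrite mem_nth // sz.
  by apply: root_location => //; [exact: d_gt0|lra].
have lims i : exists x y : R, (fun M => complex.Re (z M i)) @ F --> x /\
    (fun M => complex.Im (z M i)) @ F --> y.
  have [|x cx] := @ultra_cvg_segment F FU (fun M => complex.Re (z M i)) Z.
    by apply: filterS loc => M /(_ i)[zZ _ _]; apply: le_trans (normc_ge_absRe _) zZ.
  have [|y cy] := @ultra_cvg_segment F FU (fun M => complex.Im (z M i)) Z.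
    by apply: filterS loc => M /(_ i)[zZ _ _]; apply: le_trans (normc_ge_absIm _) zZ.
  by exists x, y.
have [zs zsP] : exists zs : 'I_n0 -> C, forall i,
    (fun M => complex.Re (z M i)) @ F --> complex.Re (zs i) /\
    (fun M => complex.Im (z M i)) @ F --> complex.Im (zs i).
  suff H i : exists zi : C, (fun M => complex.Re (z M i)) @ F --> complex.Re zi /\
    (fun M => complex.Im (z M i)) @ F --> complex.Im zi.
    by have [zs zsP] := choice H; exists zs.
  by have [x [y xy]] := lims i; exists (x +i* y).
exists zs; split=> [i|zeta j jI].
  have [cx cy] := zsP i; set x := complex.Re _ in cx *; set y := complex.Im _ in cy.
  have y0 : 2 * y <= 0.
    have cr : (fun M => d M * Z ^+ 2) @ F --> (0 : R).
      by rewrite -[0](mul0r (Z ^+ 2)); apply: cvgM => //; exact: cvg_cst.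
    have cl : (fun M => 2 * complex.Im (z M i)) @ F --> 2 * y.
      by apply: cvgM => //; exact: cvg_cst.
    by apply: (ler_cvg_to cl cr); apply: filterS loc => M /(_ i)[].
  have xy : x ^+ 2 + (h - y) ^+ 2 <= R2.
    have cr : (fun M => R2 * (1 + d M * Z) ^+ 2) @ F --> R2.
      have c1 : (fun M => 1 + d M * Z) @ F --> 1 + 0 * Z.
        exact: (cvgD (cvg_cst _) (cvgM dF (cvg_cst _))).
      rewrite mul0r addr0 in c1.
      have c2 : (fun M => R2 * ((1 + d M * Z) * (1 + d M * Z))) @ F --> R2 * (1 * 1).
        exact: (cvgM (cvg_cst _) (cvgM c1 c1)).
      rewrite !mulr1 in c2.
      by under [X in X @ _]eq_fun do rewrite expr2.
    have cl : (fun M => complex.Re (z M i) ^+ 2 + (h - complex.Im (z M i)) ^+ 2) @ F -->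
        x ^+ 2 + (h - y) ^+ 2.
      rewrite !expr2; apply: cvgD; first by apply: cvgM.
      by apply: cvgM; apply: cvgB => //; exact: cvg_cst.
    by apply: (ler_cvg_to cl cr); apply: filterS loc => M /(_ i)[].
  (* As [y <= 0 < h], [(h - y)^2 >= h^2], which cancels the [h^2] in [R2]. *)
  have xA : x ^+ 2 <= A ^+ 2.
    have : 0 <= - y * h by rewrite mulr_ge0 ?(ltW h0) //; lra.
    by have := sqr_ge0 y; rewrite /R2 in xy; lra.
  rewrite -(ler_pXn2r (n := 2)) ?nnegrE //.
  by rewrite real_normK ?num_real.
pose s := enum [pred i | zs i == zeta].
have szs : size s = #|[pred i | zs i == zeta]| by rewrite /s -cardE.
have [K K0 l1] := shifted_l1 zeta.
pose e M := \sum_(i <- s) normc (z M i - zeta).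
have eM0 M : 0 <= e M by apply: sumr_ge0 => i _; exact: normc_ge0.
have e_cvg : e @ F --> (0 : R).
  have -> : (0 : R) = \sum_(i <- s) 0 by rewrite big1.
  rewrite /e; under eq_fun do rewrite big_seq; rewrite big_seq.
  apply: cvg_big => [|i]; first exact: add_continuous.
  rewrite mem_enum inE => /eqP <-; have [cx cy] := zsP i.
  have lim0 : (fun M => `|complex.Re (z M i) - complex.Re (zs i)|
     + `|complex.Im (z M i) - complex.Im (zs i)|) @ F --> (0 : R).
    rewrite -[0]addr0 -(@normr0 _ R) -{1}(subrr (complex.Re (zs i))) -(subrr (complex.Im (zs i))).
    by apply: cvgD; apply: cvg_norm; apply: cvgB => //; exact: cvg_cst.
  apply: squeeze_cvgr (cvg_cst (0 : R)) lim0; apply: nearW => M.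
  rewrite normc_ge0 /=; apply: le_trans (normc_le_ReIm _) _.
  by case: (z M i) => ? ?; case: (zs i).
have e_small : \forall M \near F, e M <= 1 / 2.
  move/cvgrPdist_le: e_cvg => /(_ (1 / 2)) H.
  by apply: filterS (H _) => [M|]; rewrite ?sub0r ?normrN ?divr_gt0 //; apply: le_trans; exact: ler_norm.
have bound : \forall M \near F,
    normc ((shifted M zeta)`_j - 0) <= (size s)%:R * e M * 2 ^+ size s * K.
  have l1F := Foo _ l1; apply: filterS3 FM e_small l1F => M [M1M M0] e2 l1M.
  have [sz [q PE] _] := WP M M1M; have dM0 := d_gt0 M0.
  set S := 'i%C * (d M)%:C.
  have ni : normc 'i%C = 1 :> R by rewrite /= expr0n expr1n add0r sqrtr1.
  have S0 : S != 0.
    by rewrite -normc_gt0 normcMz ni mul1r normc_real normr_gt0 gt_eqF.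
  (* For [w = 1 + S z], substituting [1 + S (zeta + X)] in [X - w] gives [S (X - (z - zeta))]; the
     powers of [S] go into the cofactor. *)
  have fact : exists q', shifted M zeta =
      (\prod_(x <- [seq z M i - zeta | i <- s]) ('X - x%:P)) * q'.
    rewrite -shiftedE PE -/S.
    have -> : \prod_(w <- W M) ('X - w%:P) =
        \prod_(i <- s) ('X - ((W M)`_i)%:P) *
        \prod_(i < n0 | zs i != zeta) ('X - ((W M)`_i)%:P).
      rewrite (big_nth 0) big_mkord sz /s big_enum /=.
      by rewrite [LHS](bigID (fun i => zs i == zeta)).
    rewrite -mulrA comp_polyM rmorph_prod /= big_map.
    exists (S ^+ size s *: ((\prod_(i < n0 | zs i != zeta) ('X - ((W M)`_i)%:P) * q)
       \Po ((1 + S * zeta)%:P + S *: 'X))).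
    rewrite -scalerAr scalerAl; congr (_ * _).
    have -> : S ^+ size s = \prod_(i <- s) S.
      by elim: (s) => [|i s' IHs]; rewrite ?big_nil // big_cons /= exprS IHs.
    rewrite -scaler_prod; apply: eq_bigr => i _.
    rewrite comp_polyB comp_polyX comp_polyC scalerBr -[S *: (_)%:P]mul_polyC -polyCM.
    have -> : S * (z M i - zeta) = (W M)`_i - 1 - S * zeta.
      by rewrite mulrBr /z mulrC divfK.
    by rewrite !(polyCB, polyCD); ring.
  have [q' fE] := fact; rewrite subr0.
  have := @coef_prod_XsubC_small R [seq z M i - zeta | i <- s] q' K (e M) j.
  rewrite size_map -fE; apply=> //; last by rewrite szs.
  move=> _ /mapP[i iS ->]; rewrite /e (big_rem i iS) /= lerDl.
  by apply: sumr_ge0 => i' _; exact: normc_ge0.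
have c0 : (fun M => (shifted M zeta)`_j : C^o) @ F --> (0 : C^o).
  apply: (cvg_normc bound).
  rewrite -[0](mul0r K) -(mul0r (2 ^+ size s)) -(mulr0 (size s)%:R).
  by apply: cvgM; [apply: cvgM; [apply: cvgM|]|] => //; exact: cvg_cst.
have FF : Filter F by exact: filter_filter.
have cj := @shifted_coef_cvg F FF Foo zeta j.
have := cvg_unique (@norm_hausdorff _ _) cj c0.
have jf : (j`!)%:R != 0 :> C by rewrite pnatr_eq0 -lt0n fact_gt0.
move=> eq0; apply: (mulfI (invr_neq0 jf)); rewrite mulr0 -[RHS]eq0 mulr_sumr.
by apply: eq_bigr => B _; field.
Qed.

End LimitZeros.

(** * Zeros of the exponential sum in a strip *)

Section SecularZeros.
Context {R : realType} {n : nat}.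
Local Notation C := R[i].

Lemma secular_zeros (S : 'M[C]_n) (kap L h beta A : R) (len : 'I_n -> R) :
  let b := 2 * beta / L in
  let e := expR (- (h * L / 2)) in
  let eta := 2 * e + e ^+ 2 + b * e in
  let y := h + ln kap / L in
  quasi_isometry S kap -> 1 <= kap -> 0 < L -> (forall i, L <= len i) ->
  0 < h -> 0 < beta -> 0 <= A -> b <= 1 ->
  beta * y + (1 - b) * (2 * y ^+ 2 / (A ^+ 2 + h ^+ 2) - 1) + eta < 0 ->
  exists (n0 : nat) (zs : 'I_n0 -> C),
  [/\ beta / 2 * (\sum_i len i) <= n0%:R * (beta / h + (1 - b + eta) / h ^+ 2),
   forall i, `|complex.Re (zs i)| <= A &
   forall zeta j, (j < #|[pred i | zs i == zeta]|)%N ->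
    \sum_B minor_coef S B * (('i%C * (\sum_(i in B) len i)%:C) ^+ j
       * cexp ('i%C * zeta * (\sum_(i in B) len i)%:C)) = 0].
Proof.
move=> b e eta y iso kap1 L0 Llen h0 beta0 A0 b1 neg.
have len0 i : 0 <= len i by apply: le_trans (Llen i); exact: ltW.
have e0 : 0 <= e by exact: expR_ge0.
have b0 : 0 <= b by rewrite /b divr_ge0 ?mulr_ge0 ?(ltW beta0) ?(ltW L0).
have T0 : 0 < beta / h + (1 - b + eta) / h ^+ 2.
  have eta0 : 0 <= eta by have := mulr_ge0 b0 e0; have := sqr_ge0 e; rewrite /eta; lra.
  apply: ltr_pwDl; first by rewrite divr_gt0.
  by apply: divr_ge0; [rewrite addr_ge0 ?subr_ge0|exact: sqr_ge0].
set T := _ + _ / _ in T0.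
pose x := beta / 2 * (\sum_i len i) / T.
(* The root counts are integers at least [x], hence at least its ceiling [n0], the same for all
   [M]. *)
have [n0 xn0 n0_min] : exists2 n0 : nat, x <= n0%:R & forall m : nat, x <= m%:R -> (n0 <= m)%N.
  have ex : exists m : nat, x <= m%:R.
    exists (Num.truncn x).+1; rewrite ltW //; exact: truncnS_gt.
  by case: (ex_minnP ex) => m xm m_min; exists m.
(* The strict inequality leaves room for the extra term [d * y] once [M >= m1]; the threshold [m1]
   also ensures [d * h < 1]. *)
pose slack := - (beta * y + (1 - b) * (2 * y ^+ 2 / (A ^+ 2 + h ^+ 2) - 1) + eta).
have slack0 : 0 < slack by rewrite oppr_gt0.
have y0 : 0 < y by rewrite ltr_pwDl // divr_ge0 ?ln_ge0 ?(ltW L0).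
pose d (M : nat) := L / M.*2%:R.
pose m1 := (Num.truncn (L * (h + y / slack))).+1.
have dsmall M : (m1 <= M)%N -> [/\ (0 < M)%N, d M * h < 1 & d M * y <= slack].
  move=> m1M; have M0 : (0 < M)%N by apply: leq_trans m1M.
  have M0R : 0 < M.*2%:R :> R by rewrite ltr0n double_gt0.
  have : L * (h + y / slack) < M.*2%:R.
    apply: (@lt_le_trans _ _ m1%:R); first exact: truncnS_gt.
    by rewrite ler_nat (leq_trans m1M) // -addnn leq_addr.
  have Ly : 0 < L * (y / slack) by rewrite mulr_gt0 // divr_gt0.
  have Lh : 0 < L * h by rewrite mulr_gt0.
  rewrite mulrDr => lt; split=> //.
    by rewrite /d mulrAC ltr_pdivrMr // mul1r; lra.
  rewrite /d mulrAC ler_pdivrMr // -ler_pdivrMl // mulrC -mulrA; lra.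
have [|zs [zsA zs0]] := @limit_zeros R n (minor_coef S) len L h A n0 m1 len0 L0 h0 A0.
  move=> M /dsmall[M0 dh dy]; have dM0 : 0 < d M by rewrite divr_gt0 // ltr0n double_gt0.
  have Mk i : (M.*2 <= bond_count (d M) len i)%N.
    have /andP[lo _] := bond_count_bounds dM0 (len0 i).
    rewrite -(ler_nat R) -(ler_pM2l dM0); apply: le_trans lo.
    rewrite /d divfK ?pnatr_eq0 ?double_eq0 -?lt0n //.
  have R20 : 0 < A ^+ 2 + h ^+ 2 by rewrite ltr_wpDl ?sqr_ge0 // exprn_gt0.
  have [|rs [PE rs1 cnt]] := @count_bond_poly_roots R n S kap _ M L h beta _ iso kap1 M0 Mk
    L0 h0 beta0 R20 b1 dh.
    rewrite -/b -/y -/e -/eta -/(d M).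
    have : (1 - b) * (d M * y) <= slack.
      apply: le_trans dy; rewrite ler_piMl ?mulr_ge0 ?(ltW dM0) ?(ltW y0) //; lra.
    rewrite /slack; lra.
  exists rs; split=> //; apply: n0_min; rewrite /x ler_pdivrMr //.
  apply: le_trans cnt; rewrite ler_wpM2l ?divr_ge0 ?(ltW beta0) //.
  apply: ler_sum => i _; rewrite mulrC.
  by have /andP[] := bond_count_bounds dM0 (len0 i).
by exists n0, zs; split=> //; rewrite -ler_pdivrMr.
Qed.

Lemma quasi_isometry_phase (S : 'M[C]_n) kap (e : 'I_n -> C) :
  (forall i, normc (e i) = 1) -> quasi_isometry S kap ->
  quasi_isometry (\matrix_(i, j) (S i j * e j)) kap.
Proof.
move=> e1 iso u; have -> : \matrix_(i, j) (S i j * e j) *m u = S *m (diag_fun e *m u).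
  rewrite mulmxA; congr (_ *m _); apply/matrixP => i j; rewrite !mxE.
  rewrite (bigD1 j) //= big1 => [|l lj]; first by rewrite !mxE eqxx mul1r addr0.
  by rewrite !mxE (negPf lj) mul0r mulr0.
have <- : sqnorm (diag_fun e *m u) = sqnorm u.
  by apply: eq_bigr => i _; rewrite diag_fun_mul normcMz e1 mul1r.
exact: iso.
Qed.

Lemma secular_zeros_shifted (S : 'M[C]_n) (kap L h beta A x0 : R) (len : 'I_n -> R) :
  let b := 2 * beta / L in
  let e := expR (- (h * L / 2)) in
  let eta := 2 * e + e ^+ 2 + b * e in
  let y := h + ln kap / L in
  quasi_isometry S kap -> 1 <= kap -> 0 < L -> (forall i, L <= len i) ->
  0 < h -> 0 < beta -> 0 <= A -> b <= 1 ->
  beta * y + (1 - b) * (2 * y ^+ 2 / (A ^+ 2 + h ^+ 2) - 1) + eta < 0 ->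
  exists (n0 : nat) (zs : 'I_n0 -> C),
  [/\ beta / 2 * (\sum_i len i) <= n0%:R * (beta / h + (1 - b + eta) / h ^+ 2),
   forall i, x0 - A <= complex.Re (zs i) <= x0 + A &
   forall zeta j, (j < #|[pred i | zs i == zeta]|)%N ->
    \sum_B minor_coef S B * (('i%C * (\sum_(i in B) len i)%:C) ^+ j
       * cexp ('i%C * zeta * (\sum_(i in B) len i)%:C)) = 0].
Proof.
move=> b e eta y iso kap1 L0 Llen h0 beta0 A0 b1 neg.
pose ph (i : 'I_n) : C := cexp ('i%C * x0%:C * (len i)%:C).
have ph1 i : normc (ph i) = 1.
  rewrite normc_cexp -expR0; congr expR; rewrite /=; ring.
have [n0 [zs [cnt zsA zs0]]] := secular_zeros (quasi_isometry_phase ph1 iso) kap1 L0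
  Llen h0 beta0 A0 b1 neg.
exists n0, (fun i => zs i + x0%:C); split=> // [i|zeta j jz].
  by have := zsA i; rewrite ReD ler_norml /=; lra.
have -> : zeta = (zeta - x0%:C) + x0%:C by rewrite subrK.
rewrite -[RHS](zs0 (zeta - x0%:C) j); last first.
  rewrite (_ : #|_| = #|[pred i | zs i + x0%:C == zeta]|) //.
  by apply: eq_card => i; rewrite !inE eq_sym subr_eq eq_sym.
apply: eq_bigr => B _; rewrite minor_coef_scale.
have -> : \prod_(i in B) ph i = cexp ('i%C * x0%:C * (\sum_(i in B) len i)%:C).
  by rewrite -cexp_sum; congr cexp; rewrite rmorph_sum mulr_sumr.
by rewrite mulrDr mulrDl cexpD; ring.
Qed.

End SecularZeros.

(** * Derivatives of exponential sums *)

Section ExponentialDerivatives.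
Context {R : realType}.
Local Notation C := R[i].

(** An arbitrary filter and increment [u] cover both the complex derivatives of the secular
    determinant and the one-sided real derivatives of plane waves on an edge. *)
Lemma cvg_cexp_quotient (T : Type) (F : set_system T) {FF : Filter F} (a : C) (u : T -> C) :
  (\forall x \near F, u x != 0) -> (fun x => normc (u x)) @ F --> (0 : R) ->
  (fun x => (cexp (a * u x) - 1) / u x : C^o) @ F --> (a : C^o).
Proof.
move=> un0 u0; have v0 : (fun x => 8 * normc a ^+ 2 * normc (u x)) @ F --> (0 : R).
  by rewrite -[0](mulr0 (8 * normc a ^+ 2)); apply: cvgM => //; exact: cvg_cst.
apply: (cvg_normc _ v0).
have small : \forall x \near F, normc (a * u x) <= 1 / 2.
  have : (fun x => normc a * normc (u x)) @ F --> (0 : R).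
    by rewrite -[0](mulr0 (normc a)); apply: cvgM => //; exact: cvg_cst.
  move/cvgrPdist_le => /(_ (1 / 2)) H; apply: filterS (H _) => [x|]; last by rewrite divr_gt0.
  rewrite sub0r normrN normcMz; apply: le_trans; exact: ler_norm.
apply: filterS2 un0 small => x ux le2; have nu : 0 < normc (u x) by rewrite normc_gt0.
have -> : (cexp (a * u x) - 1) / u x - a = (cexp (a * u x) - 1 - a * u x) / u x by field.
rewrite normcMz normcV ler_pdivrMr //; apply: le_trans (cexp_taylor1 le2) _.
by rewrite normcMz exprMn expr2 -!mulrA -expr2.
Qed.

Lemma derive1_exp_sum (I : finType) (g a : I -> C) (z : C) :
  ((fun w : C => \sum_i g i * cexp (a i * w) : C^o)^`())%classic z =
    \sum_i g i * a i * cexp (a i * z).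
Proof.
rewrite /derive1; apply: cvg_lim; first exact: norm_hausdorff.
have -> : (fun h : C => h^-1 *: ((\sum_i g i * cexp (a i * (h + z)) : C^o)
    - (\sum_i g i * cexp (a i * z) : C^o)) : C^o) =
  (fun h : C => \sum_i (g i * cexp (a i * z)) * ((cexp (a i * h) - 1) / h) : C^o).
  apply/funext => h; rewrite -sumrB scaler_sumr; apply: eq_bigr => i _.
  by rewrite mulrDr cexpD /GRing.scale /=; ring.
have -> : \sum_i g i * a i * cexp (a i * z) = \sum_i (g i * cexp (a i * z)) * a i.
  by apply: eq_bigr => i _; ring.
apply: cvg_big => [|i _]; first exact: add_continuous.
apply: cvgM; first exact: cvg_cst.
apply: cvg_cexp_quotient; first exact: nbhs_dnbhs_neq.
apply/cvgrPdist_lt => e e0; have eC : 0 < e%:C :> C by rewrite ltcR.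
near=> h; rewrite sub0r normrN ger0_norm ?normc_ge0 // -ltcR -normrC_normc.
by near: h; exact: dnbhs0_lt.
Unshelve. all: by end_near.
Qed.

Lemma derive1n_exp_sum (I : finType) (g a : I -> C) (j : nat) (z : C) :
  ((fun w : C => \sum_i g i * cexp (a i * w) : C^o)^`(j))%classic z =
    \sum_i g i * a i ^+ j * cexp (a i * z).
Proof.
elim: j z => [|j IH] z; first by apply: eq_bigr => i _; rewrite expr0 mulr1.
rewrite derive1nS.
have -> : ((fun w : C => \sum_i g i * cexp (a i * w) : C^o)^`(j))%classic =
    (fun w : C => \sum_i (g i * a i ^+ j) * cexp (a i * w) : C^o).
  by apply/funext => w; exact: IH.
by rewrite derive1_exp_sum; apply: eq_bigr => i _; rewrite exprSr !mulrA.
Qed.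

End ExponentialDerivatives.

(** * Numerical bounds *)

Section NumericBounds.
Context {R : realType}.

Lemma expR_ge_pow (x : R) (n : nat) : (0 < n)%N -> 0 <= 1 + x / n%:R ->
  (1 + x / n%:R) ^+ n <= expR x.
Proof.
move=> n0 x0; have {2}-> : x = n%:R * (x / n%:R).
  by rewrite mulrC divfK // pnatr_eq0 -lt0n.
by rewrite expRM_natl lerXn2r ?nnegrE ?expR_ge0 ?expR_ge1Dx.
Qed.

(** The exponent 64 suffices: [(1 + 7 / 640)^64] is about 2.006. The lower bound on [ln 2] below
    uses [(1 - 11 / 1024)^64], about 0.501. *)
Lemma ln2_le : ln 2 <= 7 / 10 :> R.
Proof.
rewrite -[leRHS]expRK ler_ln ?posrE ?expR_gt0 //.
apply: le_trans (@expR_ge_pow _ 64 _ _) => //; lra.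
Qed.

Lemma ln2_ge : 11 / 16 <= ln 2 :> R.
Proof.
rewrite -[leLHS]expRK ler_ln ?posrE ?expR_gt0 // -[11 / 16]opprK expRN.
rewrite invf_ple ?posrE ?expR_gt0 //.
apply: le_trans (@expR_ge_pow _ 64 _ _) => //; lra.
Qed.

Lemma cos_half_sqr (x : R) : 2 * cos (x / 2) ^+ 2 = 1 + cos x.
Proof.
have -> : cos x = cos (x / 2 + x / 2) by rewrite -splitr.
by rewrite cosD; have := cos2Dsin2 (x / 2); lra.
Qed.

Lemma sin_ge_cubic (y : R) : 0 <= y -> y * (1 - y ^+ 2 / 2) <= sin y.
Proof.
move=> y0; have [c cy ->] := sin_mvt y; rewrite mulrC ler_wpM2r //.
have := cos_half_sqr c; have := cos2Dsin2 (c / 2).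
have : sin (c / 2) ^+ 2 <= (y / 2) ^+ 2.
  rewrite -real_normK ?num_real //; apply: ler_sqr_ge0 => //.
  apply: le_trans (abs_sin_le _) _; rewrite normrM [`|2^-1|]ger0_norm ?invr_ge0 //.
  by rewrite ler_wpM2r ?invr_ge0 // -(ger0_norm y0).
lra.
Qed.

Lemma sqr_ge_ge (x y : R) : 0 <= y -> x ^+ 2 <= y ^+ 2 -> x <= y.
Proof.
move=> y0; have [x0|x0] := leP 0 x; first by rewrite ler_pXn2r ?nnegrE.
by move=> _; apply: le_trans (ltW x0) y0.
Qed.

(** Half-angle formulas bound [cos (pi / 16)] from below and give [sin (pi / 16)^2 <= 0.03825]. If
    [pi > 16 / 5], the cubic bound would give [sin (pi / 16) >= 0.196], whose square is 0.038416. *)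
Lemma pi_le : pi <= 16 / 5 :> R.
Proof.
rewrite leNgt; apply/negP => pi_gt.
have pi4 : pi < 4 :> R by have := @pihalf_lt2 R; lra.
have cos_pos (x : R) : 0 <= x -> x <= pi / 2 -> 0 <= cos x.
  by move=> x0 x1; apply: cos_ge0_pihalf; apply/andP; split=> //; lra.
pose y : R := pi / 16.
have c1 : 2 * cos (pi / 4) ^+ 2 = 1 :> R.
  by have := cos_half_sqr (pi / 2 : R); rewrite cos_pihalf addr0 (_ : pi / 2 / 2 = pi / 4) //; lra.
have c2 : 2 * cos (pi / 8) ^+ 2 = 1 + cos (pi / 4) :> R.
  by rewrite -cos_half_sqr (_ : pi / 4 / 2 = pi / 8) //; lra.
have c3 : 2 * cos y ^+ 2 = 1 + cos (pi / 8).
  by rewrite -cos_half_sqr (_ : pi / 8 / 2 = y) // /y; lra.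
have p1 : 707 / 1000 <= cos (pi / 4) :> R by apply: sqr_ge_ge; [apply: cos_pos|]; lra.
have p2 : 1847 / 2000 <= cos (pi / 8) :> R by apply: sqr_ge_ge; [apply: cos_pos|]; lra.
have y0 : 0 <= y by rewrite /y; lra.
have s1 := sin_ge_cubic y0; have := cos2Dsin2 y.
have s2 : 2 / 10 * (1 - (2 / 10) ^+ 2 / 2) <= y * (1 - y ^+ 2 / 2).
  have yl : 2 / 10 <= y by rewrite /y; lra.
  have yu : y <= 1 / 4 by rewrite /y; lra.
  have : 0 <= (y - 2 / 10) * (1 - (y ^+ 2 + 2 / 10 * y + 4 / 100) / 2).
    apply: mulr_ge0; first by lra.
    have : y ^+ 2 <= (1 / 4) ^+ 2 by apply: ler_sqr_ge0.
    by lra.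
  by rewrite !exprS expr0; lra.
have : (2 / 10 * (1 - (2 / 10) ^+ 2 / 2)) ^+ 2 <= sin y ^+ 2.
  by apply: ler_sqr_ge0; [lra|apply: le_trans s2 s1].
lra.
Qed.

End NumericBounds.

Section NumericTable.
Context {R : realType}.
Implicit Types (nu q e b lo : R).

(* With [Lam = 10 * ln 2 + ln kap], [h = 7 / 5 * (Lam / L)] and
   [beta = 6 / 35 * (L / Lam)], the negativity condition of [secular_zeros] follows
   from [window_weight H q b e < 1], where [y = H * (Lam / L)] and
   [A ^+ 2 + h ^+ 2 >= q * (Lam / L) ^+ 2]. *)
Definition window_weight (H q b e : R) : R :=
  6 / 35 * H + 2 * H ^+ 2 / q + b + (2 * e + e ^+ 2 + b * e).

Lemma window_weight_le (H H' q q' b b' e e' : R) : 0 <= H <= H' -> 0 < q' <= q ->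
  0 <= b <= b' -> 0 <= e <= e' -> window_weight H q b e <= window_weight H' q' b' e'.
Proof.
move=> /andP[H0 HH] /andP[q0 qq] /andP[b0 bb] /andP[e0 ee].
have q1 : 0 < q by apply: lt_le_trans qq.
apply: lerD; last first.
  apply: lerD; last by apply: ler_pM.
  by apply: lerD; [rewrite ler_wpM2l|apply: ler_sqr_ge0].
apply: lerD => //; apply: lerD; first by apply: ler_wpM2l => //; lra.
apply: ler_pM; rewrite ?mulr_ge0 ?sqr_ge0 ?invr_ge0 ?(ltW q1) //.
  by rewrite ler_wpM2l // ler_sqr_ge0.
by rewrite lef_pV2 ?posrE.
Qed.

Lemma window_weight_lt1 (H q b e : R) : 0 < q ->
  2 * H ^+ 2 < (1 - 6 / 35 * H - b - (2 * e + e ^+ 2 + b * e)) * q ->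
  window_weight H q b e < 1.
Proof.
move=> q0; rewrite -ltr_pdivrMr // /window_weight.
by rewrite ltrBrDr ltrBrDr ltrBrDr addrA [_ + b]addrC => lt; apply: le_lt_trans lt; rewrite le_eqVlt; apply/orP; left; apply/eqP; ring.
Qed.

(* Rational lower bounds for [q = log_2 Q], with [Q] quadratic in [nu = log_2 kap]. *)
Definition log_bound nu q := forall lo (m : nat), 1 <= lo <= nu ->
  2 ^+ m <= (21 / 4 * (10 + lo) * (26 / 10 + 11 / 8 * lo)) ^+ 4 -> m%:R / 4 <= q.

(* Rational upper bounds for [e = 2 ^ (- 7 / 10 * (10 + nu))]. *)
Definition cut_bound nu e := forall me : nat, me%:R <= 7 / 10 * (10 + nu) -> e <= (2 ^+ me)^-1.

(** One row treats an interval of [nu] starting at [lo], its right end being encoded in [cH]. The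
    weight is monotone in each ingredient, so a rational bound for each at the worse end suffices.
    As [2 ^+ j <= c ^+ 4] means [c >= 2^(j / 4)], [k + j / 4] is a lower bound for the base 2
    logarithm. *)
Lemma table_row nu q e b : 1 <= nu -> log_bound nu q -> cut_bound nu e ->
  0 <= b -> b * (11 / 16 * (10 + nu)) <= 12 / 35 -> 0 <= e ->
  forall (lo cH r1 b1 e1 c : R) (k j me : nat),
  1 <= lo -> lo <= nu -> nu <= cH * (10 + nu) -> 0 <= r1 -> r1 * (10 + nu) <= 4 + nu ->
  12 / 35 <= b1 * (11 / 16 * (10 + lo)) ->
  0 <= c -> 2 ^+ j <= c ^+ 4 -> 2 ^+ k * c <= 21 / 4 * (10 + lo) * (26 / 10 + 11 / 8 * lo) ->
  me%:R <= 7 / 10 * (10 + lo) -> 1 <= e1 * 2 ^+ me ->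
  2 * (7 / 5 + cH) ^+ 2 < (1 - 6 / 35 * (7 / 5 + cH) - b1
    - (2 * e1 + e1 ^+ 2 + b1 * e1)) * (k%:R + j%:R / 4 + r1 ^+ 2 + 49 / 25) ->
  window_weight (7 / 5 + nu / (10 + nu)) (q + ((4 + nu) / (10 + nu)) ^+ 2 + 49 / 25) b e < 1.
Proof.
move=> nu1 hq he b0 hb e0 lo cH r1 b1 e1 c k j me lo1 lonu cHnu r10 r1nu b1lo c0 jc kQ mele e1me.
have -> : k%:R + j%:R / 4 = (k * 4 + j)%:R / 4 :> R by rewrite natrD natrM; field.
have pow : 2 ^+ (k * 4 + j) <= (21 / 4 * (10 + lo) * (26 / 10 + 11 / 8 * lo)) ^+ 4.
  apply: (@le_trans _ _ ((2 ^+ k * c) ^+ 4)); last first.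
    by apply: lerXn2r => //; rewrite nnegrE; [|apply: le_trans kQ]; rewrite mulr_ge0 ?exprn_ge0.
  by rewrite exprMn exprD exprM ler_wpM2l ?exprn_ge0.
have n10 : 0 < 10 + nu by apply: ltr_pwDl => //; apply: le_trans nu1.
have nlo : 10 + lo <= 10 + nu by rewrite lerD2l.
set m := (k * 4 + j)%N in pow *.
have q0 : 0 < m%:R / 4 + r1 ^+ 2 + 49 / 25 :> R.
  by rewrite ltr_wpDl // addr_ge0 ?sqr_ge0 // divr_ge0.
move=> /(window_weight_lt1 q0); apply: le_lt_trans.
apply: window_weight_le; apply/andP; split => //.
- by rewrite addr_ge0 // divr_ge0 ?(ltW n10) // (le_trans _ nu1).
- by rewrite lerD2l ler_pdivrMr.
- rewrite lerD2r; apply: lerD; first by apply: (hq lo) => //; apply/andP.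
  by apply: ler_sqr_ge0 => //; rewrite ler_pdivlMr.
- have l10 : 0 < 10 + lo by apply: ltr_pwDl => //; apply: le_trans lo1.
  have l1 : 0 < 11 / 16 * (10 + lo) by rewrite mulr_gt0 // divr_gt0.
  rewrite -(ler_pM2r l1); apply: le_trans b1lo; apply: le_trans hb.
  by rewrite ler_wpM2l // ler_wpM2l // divr_ge0.
- have p0 : 0 < 2 ^+ me :> R by rewrite exprn_gt0.
  apply: (@le_trans _ _ (2 ^+ me)^-1); last by rewrite -[leLHS]mul1r ler_pdivrMr.
  by apply: he; apply: le_trans mele _; rewrite ler_wpM2l // divr_ge0.
Qed.

(** Twelve rows suffice. [nu / (10 + nu)] stays below 1 while the bound for [q] grows
    logarithmically, so the last row, with [cH = 1], covers all [nu > 190]. *)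
Lemma numeric_table nu q e b : 1 <= nu -> log_bound nu q -> cut_bound nu e ->
  0 <= b -> b * (11 / 16 * (10 + nu)) <= 12 / 35 -> 0 <= e ->
  window_weight (7 / 5 + nu / (10 + nu)) (q + ((4 + nu) / (10 + nu)) ^+ 2 + 49 / 25) b e < 1.
Proof.
move=> nu1 hq he b0 hb e0; have row := table_row nu1 hq he b0 hb e0.
clear hq he b0 hb e0; move: row; set goal := (_ < 1) => row.
have [h0|h0] := lerP nu (11 / 2).
  by apply: (row (1) (9 / 25) (9 / 20) (46 * (1 / 10) ^+ 3) ((1 / 10) ^+ 2) (17 / 10) 7%N 3%N 7%N); clear row goal; lra.
have [h1|h1] := lerP nu (11).
  by apply: (row (11 / 2) (53 * (1 / 10) ^+ 2) (61 * (1 / 10) ^+ 2) (33 * (1 / 10) ^+ 3) ((1 / 10) ^+ 3) (17 / 12) 9%N 2%N 10%N); clear row goal; lra.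
clear h0.
have [h2|h2] := lerP nu (17).
  by apply: (row (11) (63 * (1 / 10) ^+ 2) (71 * (1 / 10) ^+ 2) (24 * (1 / 10) ^+ 3) ((1 / 10) ^+ 3) (17 / 10) 10%N 3%N 10%N); clear row goal; lra.
clear h1.
have [h3|h3] := lerP nu (23).
  by apply: (row (17) (7 / 10) (77 * (1 / 10) ^+ 2) (19 * (1 / 10) ^+ 3) ((1 / 10) ^+ 3) (17 / 10) 11%N 3%N 10%N); clear row goal; lra.
clear h2.
have [h4|h4] := lerP nu (30).
  by apply: (row (23) (3 / 4) (81 * (1 / 10) ^+ 2) (16 * (1 / 10) ^+ 3) ((1 / 10) ^+ 3) (17 / 12) 12%N 2%N 10%N); clear row goal; lra.
clear h3.
have [h5|h5] := lerP nu (35).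
  by apply: (row (30) (78 * (1 / 10) ^+ 2) (17 / 20) (13 * (1 / 10) ^+ 3) ((1 / 10) ^+ 3) (1) 13%N 0%N 10%N); clear row goal; lra.
clear h4.
have [h6|h6] := lerP nu (42).
  by apply: (row (35) (81 * (1 / 10) ^+ 2) (86 * (1 / 10) ^+ 2) (12 * (1 / 10) ^+ 3) ((1 / 10) ^+ 3) (17 / 12) 13%N 2%N 10%N); clear row goal; lra.
clear h5.
have [h7|h7] := lerP nu (52).
  by apply: (row (42) (84 * (1 / 10) ^+ 2) (88 * (1 / 10) ^+ 2) (10 * (1 / 10) ^+ 3) ((1 / 10) ^+ 3) (1) 14%N 0%N 10%N); clear row goal; lra.
clear h6.
have [h8|h8] := lerP nu (66).
  by apply: (row (52) (87 * (1 / 10) ^+ 2) (9 / 10) (9 * (1 / 10) ^+ 3) ((1 / 10) ^+ 3) (17 / 12) 14%N 2%N 10%N); clear row goal; lra.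
clear h7.
have [h9|h9] := lerP nu (90).
  by apply: (row (66) (9 / 10) (92 * (1 / 10) ^+ 2) (7 * (1 / 10) ^+ 3) ((1 / 10) ^+ 3) (1) 15%N 0%N 10%N); clear row goal; lra.
clear h8.
have [h10|h10] := lerP nu (19 * 10).
  by apply: (row (90) (95 * (1 / 10) ^+ 2) (94 * (1 / 10) ^+ 2) (5 * (1 / 10) ^+ 3) ((1 / 10) ^+ 3) (1) 16%N 0%N 10%N); clear row goal; lra.
clear h9.
by apply: (row (19 * 10) (1) (97 * (1 / 10) ^+ 2) (3 * (1 / 10) ^+ 3) ((1 / 10) ^+ 3) (1) 18%N 0%N 10%N); clear row goal; lra.
Qed.

Lemma ln2_log_bound nu (X : R) : 1 <= nu -> 0 < X ->
  X * (21 / 4 * (10 + nu) * (26 / 10 + 11 / 8 * nu)) <= 1 ->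
  log_bound nu (- ln X / ln 2).
Proof.
move=> nu1 X0 XQ lo m /andP[lo1 lonu]; set Q := _ * _ * _ => pow.
have lo0 : 0 <= lo by apply: le_trans lo1.
have Q0 : 0 < Q.
  rewrite /Q mulr_gt0 //; first by rewrite mulr_gt0 ?divr_gt0 ?ltr_pwDl.
  by rewrite ltr_pwDl ?divr_gt0 // mulr_ge0 // divr_ge0.
have QX : Q <= X^-1.
  rewrite -[leRHS]mul1r ler_pdivlMr // mulrC; apply: le_trans XQ.
  apply: ler_wpM2l; first exact: ltW.
  rewrite /Q; apply: ler_pM.
  - by rewrite mulr_ge0 ?divr_ge0 // addr_ge0.
  - by rewrite addr_ge0 ?mulr_ge0 ?divr_ge0.
  - by rewrite ler_wpM2l ?divr_ge0 // lerD2l.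
  - by rewrite lerD2l ler_wpM2l // divr_ge0.
have g0 : 0 < ln 2 :> R by apply: lt_le_trans ln2_ge; rewrite divr_gt0.
rewrite ler_pdivlMr // -lnV ?posrE //.
apply: (@le_trans _ _ (ln Q)); last by rewrite ler_ln ?posrE ?invr_gt0.
rewrite mulrAC ler_pdivrMr // [leRHS]mulrC !mulr_natl -!lnXn //.
by rewrite ler_ln ?posrE ?exprn_gt0.
Qed.

Lemma expR_cut_bound nu : 0 <= nu -> cut_bound nu (expR (- (7 / 10 * (ln 2 * (10 + nu))))).
Proof.
move=> nu0 me mele; have g0 : 0 < ln 2 :> R by apply: lt_le_trans ln2_ge; rewrite divr_gt0.
have -> : (2 ^+ me)^-1 = expR (- (me%:R * ln 2)) :> R.
  by rewrite expRN expRM_natl lnK ?posrE.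
by rewrite ler_expR lerN2 mulrCA mulrC ler_wpM2l // ltW.
Qed.

(** This is [eta <= b], which brings the factor [1 - b + eta] in the count down to 1: [e] decays
    exponentially in [nu], [b] only like [1 / (10 + nu)]. *)
Lemma cut_error_le nu e b : 1 <= nu -> 0 <= e -> e <= 1 / 128 ->
  b * (7 / 10 * (10 + nu)) >= 12 / 35 -> b <= 1 ->
  e * (1 + 7 / 10 * (11 / 16 * (nu - 1))) <= 1 / 128 ->
  2 * e + e ^+ 2 + b * e <= b.
Proof.
move=> nu1 e0 e1 bL b1 ei; have n10 : 0 < 7 / 10 * (10 + nu) by lra.
have ee : e ^+ 2 <= 1 / 128 * e by rewrite expr2 ler_wpM2r.
have be : b * e <= e by rewrite ler_piMl.
apply: (@le_trans _ _ (301 / 100 * e)); first by lra.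
rewrite -(ler_pM2r n10); apply: le_trans bL.
by lra.
Qed.

End NumericTable.

Section NumericParameters.
Context {R : realType}.

Lemma ln_pow2 (n : nat) : ln (2 ^+ n) = n%:R * ln 2 :> R.
Proof. by rewrite lnXn ?mulr_natl. Qed.

Lemma sqrt_pi_div_ln2_le : Num.sqrt (pi / ln 2) <= 54 / 25 :> R.
Proof.
have g0 := @ln2_ge R; have p := @pi_le R.
have gp : 0 < ln 2 :> R by lra.
rewrite -[leRHS]ger0_norm -?sqrtr_sqr; last by lra.
rewrite ler_sqrt ?sqr_ge0 // ler_pdivrMr //; lra.
Qed.

(** [X] is the argument of the logarithm in the hypothesis on [alpha]. By [1 - exp (- t) <= t] and
    [L <= Lmax] it is bounded by a function of [nu]. The factor [21 / 4] makes the final product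
    [21 / 32 * ln 2 * sqrt (pi / ln 2)], which the numerical bounds keep below 0.993. *)
Lemma log_argument_le (K Lam L Lmax : R) :
  0 < L -> L <= Lmax -> ln 2 <= K -> Lam = ln 2 * (10 + K / ln 2) ->
  let X := L * ln 2 * ((1 - expR (- (ln 2 / (Lam / L) ^+ 2 / L ^+ 2))) /
     (8 * (2 * Lmax * ((1 + K) / L) + 6 / 10))) * (Num.sqrt (pi / ln 2) * (Lam / L)) in
  0 < X /\ X * (21 / 4 * (10 + K / ln 2) * (26 / 10 + 11 / 8 * (K / ln 2))) <= 1.
Proof.
set g : R := ln 2; set nu := K / g => L0 LL gK LamE.
have gl : 11 / 16 <= g := ln2_ge; have gu : g <= 7 / 10 := ln2_le.
have gp : 0 < g by apply: lt_le_trans gl; lra.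
have S1 : Num.sqrt (pi / g) <= 54 / 25 := sqrt_pi_div_ln2_le.
have S0 : 0 < Num.sqrt (pi / g) by rewrite sqrtr_gt0 divr_gt0 ?pi_gt0.
set S := Num.sqrt _ in S1 S0 *.
have KE : K = g * nu by rewrite /nu mulrC divfK ?gt_eqF.
have nu1 : 1 <= nu by rewrite /nu ler_pdivlMr ?mul1r.
clearbody nu g S; move=> X.
have n10 : 0 < 10 + nu by lra.
have Lam0 : 0 < Lam by rewrite LamE mulr_gt0.
pose t := g / (Lam / L) ^+ 2 / L ^+ 2.
have tE : t = g / Lam ^+ 2 by rewrite /t; field; rewrite !gt_eqF.
have t0 : 0 < t by rewrite tE divr_gt0 ?exprn_gt0.
have e1 : 1 - expR (- t) <= t by have := expR_ge1Dx (- t); lra.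
have e0 : 0 < 1 - expR (- t) by rewrite subr_gt0 -[ltRHS]expR0 ltr_expR oppr_lt0.
pose D := 8 * (2 * Lmax * ((1 + K) / L) + 6 / 10).
have K0 : 0 < 1 + K by rewrite KE; have := mulr_gt0 gp (lt_le_trans ltr01 nu1); lra.
have Dl : 8 * (26 / 10 + 11 / 8 * nu) <= D.
  have l1 : 1 + K <= Lmax * ((1 + K) / L).
    rewrite mulrCA ler_peMr ?(ltW K0) // ler_pdivlMr // mul1r; exact: LL.
  have l2 : 11 / 16 * nu <= K by rewrite KE ler_wpM2r //; lra.
  by rewrite /D -mulrA; lra.
have D1 : 0 < 26 / 10 + 11 / 8 * nu by lra.
have D0 : 0 < D by lra.
have XE : X = (1 - expR (- t)) / D * (g * S * Lam) by rewrite /X -/t -/D; field; rewrite !gt_eqF.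
split; first by rewrite XE mulr_gt0 ?divr_gt0 // !mulr_gt0.
have Xle : X <= t / (8 * (26 / 10 + 11 / 8 * nu)) * (g * S * Lam).
  rewrite XE; apply: ler_wpM2r; first by rewrite !mulr_ge0 // ltW.
  apply: ler_pM => //; [exact: ltW|by rewrite invr_ge0 ltW|].
  by rewrite lef_pV2 ?posrE // mulr_gt0.
have XE2 : t / (8 * (26 / 10 + 11 / 8 * nu)) * (g * S * Lam) *
    (21 / 4 * (10 + nu) * (26 / 10 + 11 / 8 * nu)) = 21 / 32 * (g * S).
  rewrite tE LamE; move: (26 / 10 + 11 / 8 * nu) D1 => d d0.
  by field; rewrite !gt_eqF.
have gS : g * S <= 7 / 10 * (54 / 25) by apply: ler_pM => //; exact: ltW.
apply: (@le_trans _ _ (21 / 32 * (g * S))); last by lra.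
rewrite -XE2; apply: ler_wpM2r => //.
by rewrite !mulr_ge0 ?(ltW n10) ?(ltW D1) //; lra.
Qed.

(** The natural scale is [Lam / L = 2 ln 32 / L - Y]; [h] and [beta] are multiples of it and of its
    inverse. With [7 / 5] and [6 / 35] the last inequality follows from [31 / 392 * S <= 6 / 35],
    that is [S <= 2352 / 1085] (about 2.168), for [S = sqrt (pi / ln 2) <= 2.16]. *)
Lemma numeric_parameters (kap L Lmax A : R) : 2 <= kap -> 0 < L -> L <= Lmax -> 0 <= A ->
  let Y := - (ln kap / L) in
  let a := ln 2 / (2 * (ln 32 / L) - Y) ^+ 2 in
  Num.sqrt ((Y - ln 16 / L) ^+ 2 - 1 / a * ln (L * ln 2 * ((1 - expR (- (a / L ^+ 2))) /
     (8 * (2 * Lmax * ((1 + ln kap) / L) + 6 / 10))) * Num.sqrt (pi / a))) <= A ->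
  exists h beta : R,
  let b := 2 * beta / L in
  let e := expR (- (h * L / 2)) in
  let eta := 2 * e + e ^+ 2 + b * e in
  let y := h + ln kap / L in
  [/\ 0 < h, 0 < beta, b <= 1,
    beta * y + (1 - b) * (2 * y ^+ 2 / (A ^+ 2 + h ^+ 2) - 1) + eta < 0 &
    Num.sqrt (pi / a) / 8 * (beta / h + (1 - b + eta) / h ^+ 2) <= beta].
Proof.
move=> kap2 L0 LL A0 Y a.
pose g : R := ln 2; pose K := ln kap; pose nu := K / g; pose Lam := g * (10 + nu).
have gl : 11 / 16 <= g := ln2_ge; have gu : g <= 7 / 10 := ln2_le.
have gp : 0 < g by apply: lt_le_trans gl; lra.
have gK : g <= K by rewrite ler_ln ?posrE // (lt_le_trans _ kap2).
have nu1 : 1 <= nu by rewrite /nu ler_pdivlMr ?mul1r.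
have KE : K = g * nu by rewrite /nu mulrC divfK ?gt_eqF.
have n10 : 0 < 10 + nu by apply: ltr_pwDl => //; apply: le_trans nu1.
have Lam0 : 0 < Lam by rewrite mulr_gt0.
have ln32 : ln 32 = 5 * g :> R by rewrite -ln_pow2; congr ln; ring.
have ln16 : ln 16 = 4 * g :> R by rewrite -ln_pow2; congr ln; ring.
have aE : a = g / (Lam / L) ^+ 2.
  rewrite /a /Y ln32 -/K KE /Lam -/g; congr (_ / _ ^+ 2).
  by field; rewrite gt_eqF.
have LL0 : 0 < Lam / L by rewrite divr_gt0.
have sqE : Num.sqrt (pi / a) = Num.sqrt (pi / g) * (Lam / L).
  have -> : pi / a = (pi / g) * (Lam / L) ^+ 2.
    by rewrite aE; field; rewrite !gt_eqF.
  by rewrite sqrtrM ?divr_ge0 ?pi_ge0 ?(ltW gp) // sqrtr_sqr gtr0_norm.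
pose X := L * g * ((1 - expR (- (g / (Lam / L) ^+ 2 / L ^+ 2))) /
  (8 * (2 * Lmax * ((1 + K) / L) + 6 / 10))) * (Num.sqrt (pi / g) * (Lam / L)).
have [X0 XQ] : 0 < X /\ X * (21 / 4 * (10 + nu) * (26 / 10 + 11 / 8 * nu)) <= 1.
  exact: (@log_argument_le K Lam L Lmax L0 LL gK erefl).
rewrite sqE aE -/K ln16 -/g -/X.
set W := (X in Num.sqrt X) => sW.
have WA : W <= A ^+ 2.
  (* A negative radicand has square root 0 by convention; then [W <= A^2] holds by sign. *)
  have [W0|W0] := leP 0 W; last by apply: le_trans (ltW W0) (sqr_ge0 _).
  by rewrite -(sqr_sqrtr W0); apply: ler_sqr_ge0 => //; exact: sqrtr_ge0.
pose q := - ln X / g; pose r := (4 + nu) / (10 + nu).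
have lq : log_bound nu q by apply: ln2_log_bound.
have q0 : 0 <= q.
  have := lq 1 0%N; rewrite mul0r; apply; first by rewrite lexx.
  by rewrite expr0 exprn_ege1 //; lra.
have WE : W = (Lam / L) ^+ 2 * (r ^+ 2 + q).
  rewrite /W /Y -/K KE /q /r /Lam; field.
  by rewrite !gt_eqF.
clearbody X; clear sW XQ X0 sqE aE ln32 ln16.
(* [49 / 25 = (7 / 5)^2] is the share of [h^2] in [A^2 + h^2], in units of [(Lam / L)^2]. *)
pose Q := q + r ^+ 2 + 49 / 25; have Q0 : 0 < Q by rewrite ltr_wpDl ?addr_ge0 ?sqr_ge0.
pose H := 7 / 5 + nu / (10 + nu).
exists (7 / 5 * (Lam / L)), (6 / 35 * (L / Lam)) => b e eta y.
have bE : b = 12 / 35 / Lam by rewrite /b; field; rewrite !gt_eqF.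
have eE : e = expR (- (7 / 10 * (g * (10 + nu)))).
  by rewrite /e -/Lam; congr expR; field; rewrite gt_eqF.
have yE : y = H * (Lam / L) by rewrite /y -/K KE /H /Lam; field; rewrite !gt_eqF.
have e0 : 0 <= e by exact: expR_ge0.
have b0 : 0 <= b by rewrite bE divr_ge0 ?(ltW Lam0) // divr_ge0.
have bL : b * Lam = 12 / 35 by rewrite bE divfK ?gt_eqF.
have Lamge : 11 / 16 * (10 + nu) <= Lam by apply: ler_wpM2r => //; exact: ltW.
have Lamle : Lam <= 7 / 10 * (10 + nu) by apply: ler_wpM2r => //; exact: ltW.
have b1 : b <= 1.
  rewrite bE ler_pdivrMr // mul1r; apply: le_trans Lamge; lra.
have ec : cut_bound nu e by rewrite eE; apply: expR_cut_bound; apply: le_trans nu1.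
have e7 : e <= 1 / 128.
  by have := ec 7%N; rewrite (_ : (2 ^+ 7)^-1 = 1 / 128 :> R); [apply; lra|field].
have be : 2 * e + e ^+ 2 + b * e <= b.
  apply: (@cut_error_le _ nu) => //; first by rewrite -bL ler_wpM2l.
  have nn : 0 <= 7 / 10 * (g * (nu - 1)) by rewrite mulr_ge0 // mulr_ge0 ?(ltW gp) // subr_ge0.
  (* Split off the value of [e] at [nu = 1], which is below [2^-7]; the remaining decay absorbs the
     linear factor by [1 + x <= exp x]. *)
  have e_split : e * (1 + 7 / 10 * (g * (nu - 1))) <= 1 / 128.
    have -> : e = expR (- (77 / 10 * g)) * (expR (7 / 10 * (g * (nu - 1))))^-1.
      by rewrite -expRN -expRD eE; congr expR; ring.
    have e77 : expR (- (77 / 10 * g)) <= 1 / 128.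
      have -> : 1 / 128 = expR (- (7%:R * g)) :> R.
        by rewrite expRN expRM_natl lnK ?posrE //; field.
      by rewrite ler_expR; lra.
    rewrite mulrAC -mulrA; apply: le_trans e77.
    rewrite ler_piMr ?expR_ge0 // ler_pdivrMr ?expR_gt0 // mul1r; exact: expR_ge1Dx.
  apply: le_trans e_split; apply: ler_wpM2l => //; rewrite lerD2l.
  apply: ler_wpM2l => //; apply: ler_wpM2r => //; by rewrite subr_ge0.
have tab : window_weight H Q b e < 1.
  apply: numeric_table => //; apply: le_trans (_ : b * Lam <= _); last by rewrite bL.
  exact: ler_wpM2l.
have R2 : (Lam / L) ^+ 2 * Q <= A ^+ 2 + (7 / 5 * (Lam / L)) ^+ 2.
  apply: (@le_trans _ _ (W + (7 / 5 * (Lam / L)) ^+ 2)); last by rewrite lerD2r.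
  by rewrite WE /Q le_eqVlt; apply/orP; left; apply/eqP; field; rewrite gt_eqF.
split=> //.
- by rewrite mulr_gt0 ?divr_gt0.
- by rewrite !mulr_gt0 ?divr_gt0 ?invr_gt0.
- have -> : 6 / 35 * (L / Lam) * y = 6 / 35 * H by rewrite yE; field; rewrite !gt_eqF.
  have v : 2 * y ^+ 2 / (A ^+ 2 + (7 / 5 * (Lam / L)) ^+ 2) <= 2 * H ^+ 2 / Q.
    have l2 : 0 < (Lam / L) ^+ 2 * Q by rewrite mulr_gt0 ?exprn_gt0.
    apply: (@le_trans _ _ (2 * y ^+ 2 / ((Lam / L) ^+ 2 * Q))).
      apply: ler_wpM2l; first by rewrite mulr_ge0 ?sqr_ge0.
      by rewrite lef_pV2 ?posrE // (lt_le_trans l2).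
    by rewrite yE le_eqVlt; apply/orP; left; apply/eqP; field; rewrite !gt_eqF.
  have v0 : 0 <= 2 * y ^+ 2 / (A ^+ 2 + (7 / 5 * (Lam / L)) ^+ 2).
    apply: divr_ge0; last by apply: addr_ge0; exact: sqr_ge0.
    by apply: mulr_ge0 => //; exact: sqr_ge0.
  set V := 2 * y ^+ 2 / _ in v v0 *.
  have : (1 - b) * (V - 1) <= 2 * H ^+ 2 / Q - 1 + b.
    by have := mulr_ge0 b0 v0; clear - v; lra.
  by move: tab; rewrite /window_weight -/eta; lra.
have S1 : Num.sqrt (pi / g) <= 54 / 25 := sqrt_pi_div_ln2_le.
set S := Num.sqrt _ in S1 *.
have S0 : 0 <= S by exact: sqrtr_ge0.
have -> : S * (Lam / L) / 8 * (6 / 35 * (L / Lam) / (7 / 5 * (Lam / L)) +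
    (1 - b + eta) / (7 / 5 * (Lam / L)) ^+ 2) =
    S / 8 * (6 / 49 + (1 - b + eta) * (25 / 49)) * (L / Lam).
  by field; rewrite !gt_eqF.
apply: ler_wpM2r; first by rewrite divr_ge0 // ltW.
have : S / 8 * (6 / 49 + (1 - b + eta) * (25 / 49)) <= S / 8 * (31 / 49).
  by apply: ler_wpM2l; [rewrite divr_ge0|rewrite /eta; clear - be; lra].
by clear - S1; lra.
Qed.

End NumericParameters.

(** * Quantum graphs *)

Section VertexScattering.
Context {R : realType} {I : finType}.
Local Notation C := R[i].
Variables (P : pred I) (n : nat).
Local Notation d := #|P|.
Local Notation c := (2 / (n + d)%:R : R).
Hypothesis unbal : n != d.

(** Each lead receives the amplitude [c s], so the defect is the energy [n (c s)^2] lost to the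
    leads. *)
Lemma sum_sqr_vertex (x : I -> R) (s := \sum_(i | P i) x i) :
  \sum_(i | P i) (c * s - x i) ^+ 2 =
  \sum_(i | P i) x i ^+ 2 - 4 * n%:R / (n + d)%:R ^+ 2 * s ^+ 2.
Proof.
have -> : \sum_(i | P i) (c * s - x i) ^+ 2 =
    \sum_(i | P i) (c * s) ^+ 2 - \sum_(i | P i) (2 * c * s) * x i + \sum_(i | P i) x i ^+ 2.
  by rewrite -sumrB -big_split /=; apply: eq_bigr => i _; ring.
rewrite -mulr_sumr -/s sumr_const -[X in X - _ + _]mulr_natl.
(* A vertex with [n = d = 0] would be balanced. *)
have m0 : (n + d)%:R != 0 :> R.
  by rewrite pnatr_eq0 addn_eq0; apply: contra unbal => /andP[/eqP-> /eqP->].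
by rewrite natrD in m0 *; field.
Qed.

Lemma sqr_sum_le (x : I -> R) :
  (\sum_(i | P i) x i) ^+ 2 <= d%:R * \sum_(i | P i) x i ^+ 2.
Proof.
set s := \sum_(i | P i) x i; have [d0|d0] := posnP d.
  by rewrite /s big_pred0 ?expr0n ?d0 ?mul0r // => i; exact: (card0_eq d0).
have : 0 <= \sum_(i | P i) (d%:R * x i - s) ^+ 2 by apply: sumr_ge0 => i _; exact: sqr_ge0.
have -> : \sum_(i | P i) (d%:R * x i - s) ^+ 2 =
    \sum_(i | P i) s ^+ 2 - \sum_(i | P i) (2 * d%:R * s) * x i +
    \sum_(i | P i) d%:R ^+ 2 * x i ^+ 2.
  by rewrite -sumrB -big_split /=; apply: eq_bigr => i _; ring.
rewrite sumr_const -!mulr_sumr -/s -[X in X - _ + _]mulr_natl.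
set X := \sum_(i | _) _.
have -> : d%:R * s ^+ 2 - 2 * d%:R * s * s + d%:R ^+ 2 * X = d%:R * (d%:R * X - s ^+ 2) by ring.
by rewrite pmulr_rge0 ?ltr0n // subr_ge0.
Qed.

(** By Cauchy-Schwarz constant vectors lose most, and on them the squared norm is multiplied by
    [((n - d) / (n + d))^2]. As [n] and [d] are distinct integers, this is at least
    [1 / (n + d)^2]. *)
Lemma real_vertex_quasi_isometry (x : I -> R) (kap : R) (s := \sum_(i | P i) x i) :
  (n + d)%:R <= kap ->
  \sum_(i | P i) (c * s - x i) ^+ 2 <= \sum_(i | P i) x i ^+ 2 <=
    kap ^+ 2 * \sum_(i | P i) (c * s - x i) ^+ 2.
Proof.
move=> kapm; have := sqr_sum_le x; rewrite sum_sqr_vertex -/s.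
set X := \sum_(i | P i) _ => sX; have X0 : 0 <= X by apply: sumr_ge0 => i _; exact: sqr_ge0.
have m1 : (0 < n + d)%N.
  by rewrite lt0n addn_eq0; apply: contra unbal => /andP[/eqP-> /eqP->].
set m : R := (n + d)%:R in kapm *; have m0 : 0 < m by rewrite ltr0n.
have q0 : 0 <= 4 * n%:R / m ^+ 2 by rewrite divr_ge0 ?mulr_ge0 ?sqr_ge0.
apply/andP; split; first by rewrite gerBl mulr_ge0 ?sqr_ge0.
have low : X / m ^+ 2 <= X - 4 * n%:R / m ^+ 2 * s ^+ 2.
  apply: (@le_trans _ _ (X - 4 * n%:R / m ^+ 2 * (d%:R * X))); last first.
    by rewrite lerD2l lerN2 ler_wpM2l.
  have -> : X - 4 * n%:R / m ^+ 2 * (d%:R * X) = (n%:R - d%:R) ^+ 2 * (X / m ^+ 2).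
    by rewrite /m natrD; field; rewrite -natrD pnatr_eq0 -lt0n.
  apply: ler_peMl; first by rewrite divr_ge0 ?sqr_ge0.
  rewrite -real_normK ?num_real // exprn_ege1 //.
  have -> : n%:R - d%:R = (n%:Z - d%:Z)%:~R :> R by rewrite rmorphB.
  rewrite -intr_norm ler1z -gtz0_ge1 normr_gt0 subr_eq0; exact: unbal.
apply: le_trans (ler_wpM2l (sqr_ge0 kap) low).
rewrite mulrCA ler_peMr // ler_pdivlMr ?exprn_gt0 // mul1r.
by rewrite ler_sqr ?nnegrE ?(ltW m0) // (le_trans (ltW m0)).
Qed.

Lemma vertex_quasi_isometry (w : I -> C) (kap : R) (s := \sum_(i | P i) w i) :
  (n + d)%:R <= kap ->
  \sum_(i | P i) normc (c%:C * s - w i) ^+ 2 <= \sum_(i | P i) normc (w i) ^+ 2 <=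
    kap ^+ 2 * \sum_(i | P i) normc (c%:C * s - w i) ^+ 2.
Proof.
move=> kapm.
have reE : complex.Re s = \sum_(i | P i) complex.Re (w i) by exact: Re_sum.
have imE : complex.Im s = \sum_(i | P i) complex.Im (w i).
  by apply: (big_morph (@complex.Im R)) => // -[? ?] [].
have -> : \sum_(i | P i) normc (c%:C * s - w i) ^+ 2 =
    \sum_(i | P i) (c * (\sum_(j | P j) complex.Re (w j)) - complex.Re (w i)) ^+ 2 +
    \sum_(i | P i) (c * (\sum_(j | P j) complex.Im (w j)) - complex.Im (w i)) ^+ 2.
  rewrite -big_split /=; apply: eq_bigr => i _; rewrite sqr_normc_ReIm -reE -imE.
  by case: s {reE imE} => a b; case: (w i) => a' b' /=; ring.
have -> : \sum_(i | P i) normc (w i) ^+ 2 =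
    \sum_(i | P i) complex.Re (w i) ^+ 2 + \sum_(i | P i) complex.Im (w i) ^+ 2.
  by rewrite -big_split /=; apply: eq_bigr => i _; exact: sqr_normc_ReIm.
have /andP[r1 r2] := real_vertex_quasi_isometry (fun i => complex.Re (w i)) kapm.
have /andP[i1 i2] := real_vertex_quasi_isometry (fun i => complex.Im (w i)) kapm.
by rewrite mulrDr !lerD.
Qed.

End VertexScattering.

Section GraphMatrices.
Context {R : realType} (Q : quantum_graph R).
Local Notation C := R[i].
Implicit Types (b : bond Q) (v : vertex Q).

Lemma bond_revK : involutive (@bond_rev R Q).
Proof. by case=> e o; rewrite /bond_rev /= negbK. Qed.

(** The endpoints of an edge differ, so an edge at [v] has exactly one bond starting there. *)
Lemma card_bond_orig v : #|[pred b | bond_orig b == v]| = degree v.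
Proof.
rewrite -sum1_card big_mkcond /=.
rewrite -(pair_big xpredT xpredT (fun e o => if bond_orig (e, o) == v then 1 else 0))%N /=.
rewrite /degree -[RHS]sum1_card [RHS]big_mkcond /=; apply: eq_bigr => e _.
rewrite big_bool /bond_orig /= !inE [v == _]eq_sym [v == tgt e]eq_sym.
have := src_neq_tgt e; case: (eqVneq (src e) v) => [->|_]; first by rewrite eq_sym => /negPf->.
by rewrite add0n.
Qed.

Lemma sum_enum_bond (V : nmodType) (F : bond Q -> V) :
  \sum_(i < #|bond Q|) F (enum_val i) = \sum_b F b.
Proof. by rewrite [RHS](reindex _ (onW_bij _ (@enum_val_bij _))). Qed.

(** Indexing the amplitudes by reversed bonds decouples [S] into one map [x -> c s - x] per
    vertex. *)
Lemma S_mx_mul (u : 'cV[C]_#|bond Q|) (i : 'I_#|bond Q|) :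
  let w b := u (enum_rank (bond_rev b)) 0 in
  (S_mx Q *m u) i 0 =
    (2 / (nleads (bond_orig (enum_val i)) + degree (bond_orig (enum_val i)))%:R)%:C *
      (\sum_(b | bond_orig b == bond_orig (enum_val i)) w b) - w (enum_val i).
Proof.
set a := enum_val i; move=> w.
have -> : (S_mx Q *m u) i 0 = \sum_b (sigma a b)%:C * w b.
  rewrite mxE (reindex_inj (inv_inj bond_revK)) -sum_enum_bond; apply: eq_bigr => j _.
  by rewrite mxE /w bond_revK enum_valK.
rewrite mulr_sumr (bigID (fun b => bond_orig b == bond_orig a)) /= [X in _ + X]big1 ?addr0.
  rewrite -[w a](big_pred1_eq +%R a w).
  rewrite [X in _ - X](_ : _ = \sum_(b | bond_orig b == bond_orig a) (a == b)%:R * w b).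
    rewrite -sumrB; apply: eq_bigr => b /eqP ob.
    by rewrite /sigma ob eqxx rmorphB mulrBl /= rmorph_nat.
  rewrite [RHS](bigD1 a) //= eqxx mul1r big_pred1_eq [X in _ + X]big1 ?addr0 // => b /andP[_ ba].
  by rewrite eq_sym (negPf ba) mul0r.
by move=> b ob; rewrite /sigma eq_sym (negPf ob) mul0r.
Qed.

Lemma S_mx_quasi_isometry (kap : R) :
  unbalanced Q -> (forall v, (nleads v + degree v)%:R <= kap) -> quasi_isometry (S_mx Q) kap.
Proof.
move=> unb bnd u; pose w b := u (enum_rank (bond_rev b)) 0.
pose m v : R := 2 / (nleads v + degree v)%:R.
pose t b := (m (bond_orig b))%:C * (\sum_(b' | bond_orig b' == bond_orig b) w b') - w b.
have -> : sqnorm (S_mx Q *m u) = \sum_b normc (t b) ^+ 2.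
  by rewrite /sqnorm -sum_enum_bond; apply: eq_bigr => i _; rewrite S_mx_mul.
have -> : sqnorm u = \sum_b normc (w b) ^+ 2.
  rewrite (reindex_inj (inv_inj bond_revK)) /sqnorm -sum_enum_bond; apply: eq_bigr => i _.
  by rewrite /w bond_revK enum_valK.
have part (F : bond Q -> R) : \sum_b F b = \sum_v \sum_(b | bond_orig b == v) F b :> R.
  by rewrite (partition_big (@bond_orig R Q) xpredT).
rewrite !part mulr_sumr.
have K v : \sum_(b | bond_orig b == v) normc (t b) ^+ 2 <=
    \sum_(b | bond_orig b == v) normc (w b) ^+ 2 <=
    kap ^+ 2 * \sum_(b | bond_orig b == v) normc (t b) ^+ 2.
  have unbv : nleads v != #|[pred b | bond_orig b == v]| by rewrite card_bond_orig; exact: unb.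
  have := @vertex_quasi_isometry R (bond Q) [pred b | bond_orig b == v] _ unbv w kap.
  rewrite card_bond_orig => /(_ (bnd v)).
  rewrite (_ : \sum_(b | bond_orig b == v) normc (t b) ^+ 2 = \sum_(b in [pred b | bond_orig b == v])
     normc ((m v)%:C * (\sum_(i in [pred b | bond_orig b == v]) w i) - w b) ^+ 2) //.
  by apply: eq_bigr => b /eqP ob; rewrite /t ob.
by rewrite !ler_sum // => v _; have /andP[] := K v.
Qed.

Lemma secular_det_sum z : secular_det Q z =
  \sum_(B : {set 'I_#|bond Q|}) minor_coef (S_mx Q) B *
    cexp ('i%C * (\sum_(i in B) bond_len (enum_val i))%:C * z).
Proof.
rewrite /secular_det /U_mx /D_mx det_one_sub_diag; apply: eq_bigr => B _.
by rewrite -cexp_sum; congr (_ * cexp _); rewrite rmorph_sum mulr_sumr mulr_suml;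
  apply: eq_bigr => i _; ring.
Qed.

Lemma sum_bond_len : \sum_(i < #|bond Q|) bond_len (enum_val i) = 2 * total_length Q.
Proof.
rewrite sum_enum_bond -(pair_big xpredT xpredT (fun e o => @bond_len R Q (e, o))) /=.
by rewrite mulr_sumr; apply: eq_bigr => e _; rewrite big_bool /bond_len /=; ring.
Qed.

End GraphMatrices.

(** * Resonant states as plane waves *)

Section PlaneWaves.
Context {R : realType}.
Local Notation C := R[i].

Definition plane_wave (z al be : C) (x : R) : C :=
  al * cexp ('i%C * z * x%:C) + be * cexp (- ('i%C * z) * x%:C).

Lemma plane_wave0 z al be : plane_wave z al be 0 = al + be.
Proof. by rewrite /plane_wave !mulr0 cexp0 !mulr1. Qed.

Lemma cvg_plane_wave_quotient (F : set_system R) {FF : Filter F} (z al be : C) (t : R) :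
  (\forall x \near F, x != t) -> x @[x --> F] --> t ->
  (fun x => (plane_wave z al be x - plane_wave z al be t) / (x - t)%:C : C^o) @ F -->
    (plane_wave z ('i%C * z * al) (- ('i%C * z) * be) t : C^o).
Proof.
move=> neq lim.
have n0 : \forall x \near F, (x - t)%:C != 0 :> C.
  by apply: filterS neq => x; rewrite -subr_eq0 -[_ == 0 in X in X -> _](inj_eq (@complexI R)).
have l0 : (fun x => normc (x - t)%:C) @ F --> (0 : R).
  under eq_cvg do rewrite normc_real.
  apply/cvgrPdist_lt => e e0; move/cvgrPdist_lt: lim => /(_ e e0).
  by apply: filterS => x; rewrite sub0r normrN normr_id distrC.
have ca := @cvg_cexp_quotient R R F FF ('i%C * z) _ n0 l0.
have cb := @cvg_cexp_quotient R R F FF (- ('i%C * z)) _ n0 l0.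
have -> : (fun x => (plane_wave z al be x - plane_wave z al be t) / (x - t)%:C : C^o) =
   (fun x => al * cexp ('i%C * z * t%:C) * ((cexp ('i%C * z * (x - t)%:C) - 1) / (x - t)%:C) +
    be * cexp (- ('i%C * z) * t%:C) *
      ((cexp (- ('i%C * z) * (x - t)%:C) - 1) / (x - t)%:C) : C^o).
  apply/funext => x; rewrite /plane_wave.
  have E a : cexp (a * x%:C) = cexp (a * t%:C) * cexp (a * (x - t)%:C) :> C.
    by rewrite -cexpD -mulrDr -rmorphD /= addrC subrK.
  rewrite !E; ring.
have -> : plane_wave z ('i%C * z * al) (- ('i%C * z) * be) t =
    al * cexp ('i%C * z * t%:C) * ('i%C * z) + be * cexp (- ('i%C * z) * t%:C) * - ('i%C * z).
  by rewrite /plane_wave; ring.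
exact: (cvgD (cvgM (cvg_cst _) ca) (cvgM (cvg_cst _) cb)).
Qed.

Lemma is_derive_plane_wave (A : set R) z al be : is_derive_on A (plane_wave z al be)
  (plane_wave z ('i%C * z * al) (- ('i%C * z) * be)).
Proof.
move=> t _; apply: cvg_plane_wave_quotient.
  by rewrite /prop_near1 /nbhs /= /within /=; apply: filterS (nbhs_dnbhs_neq t) => x xt _.
by apply: cvg_trans (cvg_within _) _; exact: nbhs_dnbhs.
Qed.

Lemma continuous_plane_wave z al be : continuous (plane_wave z al be : R -> C^o).
Proof.
move=> t; apply/continuous_withinNx; set g : C := plane_wave z al be t.
have neq : \forall x \near t^', x != t by exact: nbhs_dnbhs_neq.
have lim : x @[x --> t^'] --> t by exact: nbhs_dnbhs.
have FF : Filter (t^' : set_system R) by exact: dnbhs_filter.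
have q := @cvg_plane_wave_quotient _ FF z al be t neq lim.
have l0 : (fun x => (x - t)%:C : C^o) @ t^' --> (0 : C^o).
  apply: (@cvg_normc _ _ _ _ _ _ (fun x => `|x - t|)).
    by apply: filterE => x; rewrite subr0 normc_real.
  apply/cvgrPdist_lt => e e0; move/cvgrPdist_lt: lim => /(_ e e0).
  by apply: filterS => x; rewrite sub0r normrN normr_id distrC.
have := cvgD (@cvg_cst _ (g : C^o) _ (t^' : set_system R) FF) (cvgM q l0).
move=> /(_ FF FF); rewrite mulr0 addr0; apply: cvg_trans; apply: near_eq_cvg.
apply: filterS neq => x xt; have u0 : (x - t)%:C != 0 :> C.
  by rewrite -(rmorph0 (@real_complex R)) (inj_eq (@complexI R)) subr_eq0.
by change (g + (plane_wave z al be x - g) / (x - t)%:C * (x - t)%:C = plane_wave z al be x);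
  rewrite divfK // addrC subrK.
Qed.

Lemma is_C2_plane_wave (A : set R) z al be : is_C2_on A (plane_wave z al be)
  (plane_wave z ('i%C * z * al) (- ('i%C * z) * be))
  (plane_wave z ('i%C * z * ('i%C * z * al)) (- ('i%C * z) * (- ('i%C * z) * be))).
Proof.
split; [exact: is_derive_plane_wave|exact: is_derive_plane_wave|].
by apply: continuous_subspaceT; exact: continuous_plane_wave.
Qed.

Lemma plane_wave_neq0 (z al be : C) (L : R) : z != 0 -> 0 < L -> al != 0 ->
  exists2 x, 0 <= x <= L & plane_wave z al be x != 0.
Proof.
move=> z0 L0 al0; have [s0|] := eqVneq (plane_wave z al be 0) 0; last first.
  by move=> p0; exists 0 => //; rewrite lexx (ltW L0).
have bE : be = - al by apply/eqP; rewrite -addr_eq0 addrC -(plane_wave0 z) s0.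
have nz : 0 < normc z by rewrite normc_gt0.
have D0 : 0 < 1 + 32 * (L * normc z) by rewrite ltr_wpDr // mulr_ge0 // mulr_ge0 // ltW.
(* A zero at [x] as well would force [exp (2 i z x) = 1]. This [x] makes [w = 2 i z x] satisfy
   [16 |w| <= 1], and then [8 |w|^2 < |w|] contradicts the Taylor bound. *)
pose x := L / (1 + 32 * (L * normc z)).
have x0 : 0 < x by rewrite divr_gt0.
have xL : x <= L.
  by rewrite ler_pdivrMr // mulrDr mulr1 lerDl mulr_ge0 ?mulr_ge0 ?(ltW L0) ?(ltW nz).
exists x; first by rewrite xL (ltW x0).
pose w := 'i%C * z * x%:C *+ 2.
have nw : normc w = 2 * (normc z * x).
  rewrite /w -mulr_natl !normcMz normc_real gtr0_norm // -[X in X * _](_ : 2 = _); last first.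
    by rewrite -[2%:R in RHS](rmorph_nat (@real_complex R)) normc_real ger0_norm.
  by rewrite (_ : normc 'i%C = 1) ?mul1r // /= expr0n expr1n add0r sqrtr1.
have wle : 16 * normc w <= 1.
  have -> : 16 * normc w = 32 * (L * normc z) / (1 + 32 * (L * normc z)).
    by rewrite nw /x; field; rewrite gt_eqF.
  by rewrite ler_pdivrMr // mul1r lerDr.
have w0 : 0 < normc w by rewrite nw; do 2 apply: mulr_gt0 => //.
have tay : normc (cexp w - 1 - w) <= 8 * normc w ^+ 2 by apply: cexp_taylor1; lra.
apply: contraTneq isT => p0.
have : cexp w = 1.
  have : al * (cexp w - 1) = cexp ('i%C * z * x%:C) * plane_wave z al be x.
    have wE : cexp w = cexp ('i%C * z * x%:C) * cexp ('i%C * z * x%:C).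
      by rewrite -cexpD /w mulr2n.
    have vE : 1 = cexp ('i%C * z * x%:C) * cexp (- ('i%C * z) * x%:C).
      by rewrite -cexpD mulNr subrr cexp0.
    by rewrite /plane_wave bE wE [X in _ - X]vE; ring.
  by rewrite p0 mulr0 => /eqP; rewrite mulf_eq0 (negPf al0) subr_eq0 => /eqP.
move=> w1; move: tay; rewrite w1 subrr sub0r normcNz => tay.
have : normc w * (16 * normc w) <= normc w by rewrite ler_piMr // ltW.
by move: tay; rewrite expr2; lra.
Qed.

End PlaneWaves.

Section Resonances.
Context {R : realType} (Q : quantum_graph R).
Local Notation C := R[i].
Implicit Types (b : bond Q) (v : vertex Q).

Lemma bond_len_gt0 b : 0 < bond_len b. Proof. exact: edge_len_gt0. Qed.

(** [al] and [inc] are the outgoing and incoming amplitudes at the origin of a bond, [F] the vertex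
    values, which also drive the leads. Keeping the factor ['i%C * z] in the current condition
    includes [z = 0]. *)
Lemma plane_wave_resonance (z : C) (al : bond Q -> C) (F : vertex Q -> C)
    (inc := fun b => cexp ('i%C * z * (bond_len b)%:C) * al (bond_rev b)) :
  (exists b x, 0 <= x <= bond_len b /\ plane_wave z (al b) (inc b) x != 0) ->
  (forall b, al b + inc b = F (bond_orig b)) ->
  (forall v, 'i%C * z *
     (\sum_(b | bond_orig b == v) (al b - inc b) + (nleads v)%:R * F v) = 0) ->
  is_resonance Q z.
Proof.
move=> [b0 [x0 [x0L nz]]] cont cur.
pose amp (b : ext_bond Q) := match b with inl b => al b | inr l => F (tag l) end.
pose ret (b : ext_bond Q) := match b with inl b => inc b | inr _ => 0 end.
exists (fun b : ext_bond Q => plane_wave z (amp b) (ret b)).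
exists (fun b : ext_bond Q => plane_wave z ('i%C * z * amp b) (- ('i%C * z) * ret b)).
exists (fun b : ext_bond Q => plane_wave z ('i%C * z * ('i%C * z * amp b))
  (- ('i%C * z) * (- ('i%C * z) * ret b))).
split; first by exists (inl b0), x0; split => //=; rewrite in_itv.
split; first by move=> b; exact: is_C2_plane_wave.
split.
  move=> b x _; rewrite /plane_wave /= /inc bond_revK.
  have -> : bond_len (bond_rev b) = bond_len b by [].
  rewrite rmorphB !mulrBr !mulNr !cexpD opprK.
  have E : cexp (- ('i%C * z * (bond_len b)%:C)) * cexp ('i%C * z * (bond_len b)%:C) = 1.
    by rewrite -cexpD addNr cexp0.
  rewrite addrC; congr (_ + _); first by ring.
  by rewrite -[LHS]mulr1 -E; ring.
split.
  have val (b : ext_bond Q) : plane_wave z (amp b) (ret b) 0 = F (ext_orig b).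
    by rewrite plane_wave0; case: b => [b|l] /=; rewrite ?cont ?addr0.
  by move=> b b' ob; rewrite !val ob.
split.
  move=> v; rewrite -[RHS](cur v) big_sumType /= mulrDr; congr (_ + _).
    by rewrite mulr_sumr; apply: eq_bigr => b _; rewrite plane_wave0; ring.
  transitivity (\sum_(l : lead Q | tag l == v) 'i%C * z * F v).
    by apply: eq_bigr => l /eqP <-; rewrite plane_wave0 mulr0 addr0.
  rewrite sumr_const [RHS]mulrCA [RHS]mulr_natl; congr (_ *+ _).
  rewrite -[RHS]card_ord -sum1_card big_mkcond /=.
  have -> : (\sum_(l : lead Q) (if l \in [pred l | tag l == v] then 1 else 0) =
      \sum_w \sum_(i < nleads w) (if w == v then 1 else 0))%N.
    by rewrite sig_big_dep.
  rewrite (bigD1 v) //= eqxx [X in (_ + X)%N]big1 ?addn0 ?sum1_card // => w /negPf->.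
  by rewrite big1.
split; last by move=> l x _; rewrite plane_wave0 /plane_wave /= mul0r !addr0.
move=> b x _; rewrite /plane_wave.
have i2 : 'i%C * 'i%C = -1 :> C by rewrite -expr2 sqr_i.
have E (c u : C) : 'i%C * z * ('i%C * z * c) * u = ('i%C * 'i%C) * (z ^+ 2 * c * u) by ring.
by rewrite [- _ * (- _ * _)]mulrA mulrNN -[_ * _ * ret b]mulrA !E i2; ring.
Qed.

Lemma secular_zero_resonance (z : C) : unbalanced Q -> secular_det Q z = 0 -> is_resonance Q z.
Proof.
move=> unb /det0_col[u u0]; rewrite mulmxBl mul1mx => /eqP; rewrite subr_eq0 => /eqP uE.
have [i ui] : exists i, u i 0 != 0.
  apply/existsP; apply: contraNT u0; rewrite negb_exists => /forallP H.
  by apply/eqP/matrixP => i j; rewrite ord1 mxE; apply/eqP; rewrite -[_ == _]negbK.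
(* At [z = 0] a nonzero amplitude vector may give the zero function, so the constant function 1 is
   used instead. *)
have [->|z0] := eqVneq z 0.
  apply: (@plane_wave_resonance 0 (fun=> 2^-1) (fun=> 1)).
  - exists (enum_val i), 0; rewrite lexx (ltW (bond_len_gt0 _)); split=> //.
    rewrite plane_wave0 mulr0 mul0r cexp0 mul1r (_ : _ + _ = 1) ?oner_neq0 //.
    by rewrite -div1r -splitr.
  - by move=> b; rewrite mulr0 mul0r cexp0 mul1r -div1r -splitr.
  - by move=> v; rewrite mulr0 mul0r.
pose al b := u (enum_rank b) 0.
pose inc b := cexp ('i%C * z * (bond_len b)%:C) * al (bond_rev b).
pose F v := (2 / (nleads v + degree v)%:R : R)%:C * \sum_(b | bond_orig b == v) inc b.
have incE b : (D_mx Q z *m u) (enum_rank (bond_rev b)) 0 = inc b.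
  by rewrite (diag_fun_mul (fun i => cexp ('i%C * z * (bond_len (enum_val i))%:C))) enum_rankK.
(* The fixed vector equation [u = S D u], read at the origin of [b], is exactly continuity there. *)
have alE b : al b = F (bond_orig b) - inc b.
  rewrite {1}/al uE /U_mx -mulmxA S_mx_mul enum_rankK incE.
  by congr (_ * _ - _); apply: eq_bigr => b' _; exact: incE.
apply: (@plane_wave_resonance z al F) => [|b|v].
- exists (enum_val i).
  have al0 : al (enum_val i) != 0 by rewrite /al enum_valK.
  have [x xL px] := plane_wave_neq0 (inc (enum_val i)) z0 (bond_len_gt0 (enum_val i)) al0.
  by exists x.
- by rewrite alE subrK.
have m0 : (nleads v + degree v)%:R != 0 :> C.
  by rewrite pnatr_eq0 addn_eq0; apply: contra (unb v) => /andP[/eqP-> /eqP->].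
have -> : \sum_(b | bond_orig b == v) (al b - inc b) =
    \sum_(b | bond_orig b == v) F v - 2 * \sum_(b | bond_orig b == v) inc b.
  rewrite mulr_sumr -sumrB; apply: eq_bigr => b /eqP <-; rewrite alE; ring.
rewrite sumr_const card_bond_orig -mulr_natl.
have -> : \sum_(b | bond_orig b == v) inc b = (nleads v + degree v)%:R / 2 * F v.
  by rewrite /F rmorphM fmorphV !rmorph_nat natrD; field; rewrite -natrD.
by rewrite natrD; field.
Qed.

End Resonances.

(** * Counting resonances with multiplicity *)

Lemma zero_order_ge (R : realType) (f : R[i] -> R[i]^o) (z : R[i]) (k : nat) :
  (forall j, (j < k)%N -> (f^`(j))%classic z = 0) -> (k%:R%:E <= zero_order f z)%E.
Proof. by move=> fz; apply: ereal_sup_ubound; exists k. Qed.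

(** The sum is restricted to the distinct values of [zs]; each has multiplicity at least its number
    of occurrences, and these numbers add up to [m]. *)
Lemma resonance_count_ge (R : realType) (Q : quantum_graph R) (Omega : set R[i])
    (m : nat) (zs : 'I_m -> R[i]) :
  unbalanced Q -> (forall i, Omega (zs i)) ->
  (forall zeta j, (j < #|[pred i | zs i == zeta]|)%N ->
    ((secular_det Q : R[i] -> R[i]^o)^`(j))%classic zeta = 0) ->
  (m%:R%:E <= resonance_count Q Omega)%E.
Proof.
move=> unb zsO zs0; apply: esum_ge; pose s := undup (codom zs).
have us : uniq s by exact: undup_uniq.
exists [set` s].
  split; first exact: finite_seq.
  move=> zeta; rewrite /= mem_undup => /codomP[i ->]; split; last exact: zsO.
  apply: secular_zero_resonance => //; apply: (zs0 (zs i) 0%N).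
  by apply/card_gt0P; exists i; rewrite inE.
rewrite -fsbig_seq //.
apply: (@le_trans _ _ (\sum_(zeta <- s) #|[pred i | zs i == zeta]|%:R%:E)%E); last first.
  by apply: lee_sum => zeta _; apply: zero_order_ge => j; exact: zs0.
rewrite sumEFin lee_fin -natr_sum ler_nat -[leqLHS]card_ord -sum1_card.
rewrite (eq_bigr (fun zeta => \sum_(i | zs i == zeta) 1)%N); last first.
  by move=> zeta _; rewrite sum1_card.
rewrite (exchange_big_dep xpredT) //=; apply: leq_sum => i _.
rewrite big_mkcond (bigD1_seq (zs i)) //= ?eqxx ?leq_addr //.
by rewrite mem_undup codom_f.
Qed.

Theorem proposition1 (R : realType) (D n0 : nat) (Lmin Lmax : R)
    (Q : quantum_graph R) (x0 alpha : R) :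
  (0 < D)%N -> (0 < n0)%N ->
  0 < Lmin -> Lmin <= Lmax ->
  bounded_graph D n0 Lmin Lmax Q ->
  unbalanced Q ->
  let Y := - (ln ((D + n0)%:R : R) / Lmin) in
  let a := ln 2 / (2 * (ln 32 / Lmin) - Y) ^+ 2 in
  0 < alpha ->
  Num.sqrt
    ((Y - ln 16 / Lmin) ^+ 2
     - 1 / a *
       ln (Lmin * ln 2 *
           ((1 - expR (- (a / Lmin ^+ 2))) /
            (8 * (2 * Lmax * ((1 + ln (D + n0)%:R) / Lmin) + 6 / 10))) *
           Num.sqrt (pi / a)))
    <= alpha / Lmin ->
  ((total_length Q / 8 * Num.sqrt (pi / a))%:E <=
   resonance_count Q
     [set z : R[i] | (x0 - alpha / Lmin <= complex.Re z <= x0 + alpha / Lmin)%R])%E.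
Proof.
move=> D0 n00 L0 LL [degs lens] unb Y a alpha0 hyp.
pose kap : R := (D + n0)%:R; pose A := alpha / Lmin.
have kap2 : 2 <= kap by rewrite /kap ler_nat (leq_add D0 n00).
have A0 : 0 <= A by rewrite divr_ge0 // ltW.
have [h [beta [h0 beta0 b1 neg cnt]]] := numeric_parameters kap2 L0 LL A0 hyp.
have iso : quasi_isometry (S_mx Q) kap.
  apply: S_mx_quasi_isometry => // v; have [dv nv] := degs v.
  by rewrite ler_nat addnC leq_add.
pose len (i : 'I_#|bond Q|) := bond_len (enum_val i).
have lenL i : Lmin <= len i by have /andP[] := lens (enum_val i).1.
have kap1 : 1 <= kap by apply: le_trans kap2; rewrite ler1n.
have [m [zs [low strip zs0]]] :=
  secular_zeros_shifted x0 iso kap1 L0 lenL h0 beta0 A0 b1 neg.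
apply: le_trans (_ : m%:R%:E <= _)%E; last first.
  apply: (@resonance_count_ge _ _ _ _ zs) => // zeta j jz.
  have -> : (secular_det Q : R[i] -> R[i]^o) =
      (fun z => \sum_(B : {set 'I_#|bond Q|}) minor_coef (S_mx Q) B *
         cexp ('i%C * (\sum_(i in B) len i)%:C * z) : R[i]^o).
    by apply/funext => z; exact: secular_det_sum.
  rewrite derive1n_exp_sum -[RHS](zs0 zeta j jz); apply: eq_bigr => B _.
  by rewrite -mulrA [in RHS]mulrAC.
rewrite lee_fin; move: cnt low.
set S := Num.sqrt _; set T := beta / h + _ => cnt.
rewrite sum_bond_len => low.
have T0 : 0 < T.
  rewrite /T ltr_pwDl ?divr_gt0 // divr_ge0 ?sqr_ge0 //.
  by rewrite addr_ge0 ?subr_ge0 // !addr_ge0 ?mulr_ge0 ?sqr_ge0 ?invr_ge0 ?expR_ge0 // ltW.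
have tot : 0 <= total_length Q by apply: sumr_ge0 => e _; rewrite ltW // edge_len_gt0.
(* Every edge carries two bonds, so [low] reads [beta * total_length Q <= m * T], to be combined
   with [S / 8 * T <= beta]. *)
rewrite -(ler_pM2r T0); apply: le_trans low.
by have := ler_wpM2l tot cnt; rewrite /T; lra.
Qed.
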